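(* The zero locus in $OG(2,9)$ of a general global section of the spinor bundle $\mathcal{S}$ is isomorphic to $OG(2,7)$.
   Context: Over $\mathbb{C}$. $OG(k,m)$ is the orthogonal Grassmannian of isotropic $k$-dimensional subspaces of $\mathbb{C}^m$ with a non-degenerate quadratic form. $\Delta$ is the $16$-dimensional spin representation of $Spin_9$, with Clifford action $V\otimes\Delta\to\Delta$, $V=\mathbb{C}^9$. The spinor bundle $\mathcal{S}$ on $OG(2,9)$ is the homogeneous bundle of rank $4$ whose fiber at $[U]$ is the cokernel of $U\otimes\Delta\to\Delta$; $H^0(\mathcal{S})=\Delta$. *)

(* Defs.v *)
From HB Require Import structures.
From mathcomp Require Import all_boot all_order all_algebra.
From mathcomp Require Import boolp classical_sets functions reals.
From mathcomp Require Import complex.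
From mathcomp Require Import mpoly.

Set Implicit Arguments.
Unset Strict Implicit.
Unset Printing Implicit Defensive.

Import Order.TTheory GRing.Theory Num.Theory.
Local Open Scope classical_set_scope.
Local Open Scope ring_scope.

(* The base field C is [R[i]] for a [realType] R.

   Schemes over C are given by their functors of points on commutative
   C-algebras, with the usual moduli description of (orthogonal) Grassmannians:
   Gr(k, m) sends A to the set of direct summands of A^m of constant rank k, and
   a C-algebra map f : A -> B sends W to the submodule of B^m generated by f(W).
   By Yoneda, two schemes are isomorphic exactly when their functors of points
   are naturally isomorphic.  (The library's [comAlgType]s are nonzero rings;
   this is harmless, since Spec of the zero ring is empty.) *)

Section Grassmannians.
Variable R : realType.
Local Notation C := R[i].

(* Subfunctors of the functor of submodules of A^m, objects only. *)
Definition submod_functor (m : nat) : Type :=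
  forall A : comAlgType C, set (set 'cV[A]_m).

Definition base_change (A B : comAlgType C) (f : {lrmorphism A -> B}) m
    (W : set 'cV[A]_m) : set 'cV[B]_m :=
  [set v | exists (r : nat) (b : 'I_r -> B) (w : 'I_r -> 'cV[A]_m),
     (forall i, W (w i)) /\ v = \sum_(i < r) b i *: map_mx f (w i)].

Definition isomorphic m n (X : submod_functor m) (Y : submod_functor n) : Prop :=
  exists phi : forall A : comAlgType C, set 'cV[A]_m -> set 'cV[A]_n,
    (forall A : comAlgType C, set_bij (X A) (Y A) (phi A)) /\
    (forall (A B : comAlgType C) (f : {lrmorphism A -> B}) (W : set 'cV[A]_m),
       X A W -> phi B (base_change f W) = base_change f (phi A W)).

(* A direct summand of A^m is the image of an idempotent matrix P; its rank is
   required to be k at every point of Spec A, i.e. after every map to a field. *)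
Definition Gr (k m : nat) : submod_functor m := fun A W =>
  exists P : 'M[A]_m,
    [/\ P *m P = P, W = range (fun u : 'cV[A]_m => P *m u)
      & forall (K : fieldType) (f : {rmorphism A -> K}),
          \rank (map_mx f P) = k].

(* The quadratic form with Gram matrix G is v |-> v^T G v. *)
Definition nondegenerate_form m (G : 'M[C]_m) : Prop :=
  G^T = G /\ G \in unitmx.

Definition quad m (G : 'M[C]_m) (A : comAlgType C) (v : 'cV[A]_m) : A :=
  (v^T *m map_mx (in_alg A) G *m v) 0 0.

Definition OG (k m : nat) (G : 'M[C]_m) : submod_functor m := fun A W =>
  Gr k W /\ forall w, W w -> quad G w = 0.

(* [gamma i] is the action of the i-th basis vector of V = C^m on Delta = C^N;
   the relations below say v . (v . d) = q(v) d.  For m odd, m = 2n+1, and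
   nondegenerate G, the Clifford algebra is a product of two matrix algebras of
   size 2^n, so for N = 2^n the representation is one of its two simple
   modules.  They differ by gamma |-> - gamma and both restrict to the spin
   representation of Spin_m, with the same images U . Delta. *)
Definition clifford_action m N (G : 'M[C]_m) (gamma : 'I_m -> 'M[C]_N) : Prop :=
  forall i j, gamma i *m gamma j + gamma j *m gamma i = (2 * G i j)%:M.

Definition clifford m N (gamma : 'I_m -> 'M[C]_N) (A : comAlgType C)
    (v : 'cV[A]_m) (d : 'cV[A]_N) : 'cV[A]_N :=
  \sum_(i < m) v i 0 *: (map_mx (in_alg A) (gamma i) *m d).

(* The image of U (x) Delta_A -> Delta_A.  The pullback of the spinor bundle
   along the point U of OG(2,9)(A) is the quotient of Delta_A by it. *)
Definition clifford_image m N (gamma : 'I_m -> 'M[C]_N) (A : comAlgType C)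
    (U : set 'cV[A]_m) : set 'cV[A]_N :=
  [set e | exists (r : nat) (u : 'I_r -> 'cV[A]_m) (d : 'I_r -> 'cV[A]_N),
     (forall i, U (u i)) /\ e = \sum_(i < r) clifford gamma (u i) (d i)].

(* The zero scheme in OG(k, m) of the section of coker(U (x) Delta -> Delta)
   defined by delta in Delta: U is an A-point of it when the class of delta in
   the cokernel over A vanishes. *)
Definition zero_locus (k m N : nat) (G : 'M[C]_m) (gamma : 'I_m -> 'M[C]_N)
    (delta : 'cV[C]_N) : submod_functor m := fun A U =>
  OG k G U /\ clifford_image gamma U (map_mx (in_alg A) delta).

(* P holds on a nonempty (hence dense) Zariski open subset of C^N; the
   nonvanishing loci of polynomials form a basis of open sets. *)
Definition for_general N (P : 'cV[C]_N -> Prop) : Prop :=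
  exists p : {mpoly C[N]}, p != 0 /\
    forall v : 'cV[C]_N, p.@[fun i => v i 0] != 0 -> P v.

End Grassmannians.

(* The functors above are indeed stable under base change. *)
Section Stability.
Variable R : realType.
Local Notation C := R[i].
Variables (A B : comAlgType C) (f : {lrmorphism A -> B}).

Lemma map_in_alg m n (M : 'M[C]_(m, n)) :
  map_mx f (map_mx (in_alg A) M) = map_mx (in_alg B) M.
Proof. by apply/matrixP => i j; rewrite !mxE /= linearZ rmorph1. Qed.

Lemma Gr_base_change k m (W : set 'cV[A]_m) :
  Gr k W -> Gr k (base_change f W).
Proof.
case=> P [PP -> rkP]; exists (map_mx f P); split.
- by rewrite -map_mxM PP.
- apply/seteqP; split=> [v [r [b [w [wP ->]]]]|_ [u _ <-]].
    exists (\sum_(i < r) b i *: map_mx f (w i)) => //.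
    rewrite mulmx_sumr; apply: eq_bigr => i _.
    by have [u _ <-] := wP i; rewrite -scalemxAr -map_mxM mulmxA PP.
  exists m, (fun i => u i 0), (fun i => P *m delta_mx i 0); split=> [i|].
    by exists (delta_mx i 0).
  rewrite {1}[u]matrix_sum_delta mulmx_sumr; apply: eq_bigr => i _.
  by rewrite big_ord1 -scalemxAr map_mxM map_delta_mx.
- move=> K g; rewrite -(rkP K (g \o f : {rmorphism A -> K})).
  by rewrite -map_mx_comp.
Qed.

Lemma OG_base_change k m (G : 'M[C]_m) (W : set 'cV[A]_m) :
  nondegenerate_form G -> OG k G W -> OG k G (base_change f W).
Proof.
case=> Gsym _ [GrW isoW]; split; first exact: Gr_base_change.
have WD x y : W x -> W y -> W (x + y).
  by case: GrW => P [_ -> _] [u _ <-] [v _ <-]; exists (u + v); rewrite ?mulmxDr.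
have bil0 x y : W x -> W y -> (x^T *m map_mx (in_alg A) G *m y) = 0.
  move=> Wx Wy; apply/matrixP => i j; rewrite !ord1 [RHS]mxE.
  have := isoW _ (WD _ _ Wx Wy).
  rewrite /quad [(x + y)^T]linearD /= !mulmxDl !mulmxDr.
  have add00 (a b : 'M[A]_1) : (a + b) 0 0 = a 0 0 + b 0 0 by rewrite mxE.
  rewrite !add00.
  have := isoW _ Wx; have := isoW _ Wy; rewrite /quad => -> ->.
  rewrite addr0 add0r.
  have -> : (y^T *m map_mx (in_alg A) G *m x) 0 0
          = (x^T *m map_mx (in_alg A) G *m y) 0 0.
    have -> : y^T *m map_mx (in_alg A) G *m x
            = (x^T *m map_mx (in_alg A) G *m y)^T.
      by rewrite !trmx_mul trmxK map_trmx Gsym mulmxA.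
    by rewrite mxE.
  rewrite -mulr2n -scaler_nat => /(congr1 (fun z => 2%:R^-1 *: z)).
  by rewrite scalerA mulVf ?pnatr_eq0 // scale1r scaler0.
move=> _ [r [b [w [Ww ->]]]].
rewrite /quad mulmx_sumr summxE big1 // => i _.
rewrite [(\sum_(i < r) _)^T]linear_sum /= !mulmx_suml summxE big1 // => j _.
rewrite -scalemxAr [(_ *: _)^T]linearZ /= -!scalemxAl -map_in_alg map_trmx -!map_mxM bil0 //.
by rewrite map_mx0 !scaler0 mxE.
Qed.

Lemma zero_locus_base_change k m N (G : 'M[C]_m) (gamma : 'I_m -> 'M[C]_N)
    (delta : 'cV[C]_N) (U : set 'cV[A]_m) :
  nondegenerate_form G -> zero_locus k G gamma delta U ->
  zero_locus k G gamma delta (base_change f U).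
Proof.
move=> hG [OGU [r [u [d [Uu de]]]]]; split; first exact: OG_base_change.
exists r, (fun i => map_mx f (u i)), (fun i => map_mx f (d i)); split=> [i|].
  exists 1%N, (fun=> 1), (fun=> u i); split=> //.
  by rewrite big_ord1 scale1r.
rewrite -map_in_alg de raddf_sum; apply: eq_bigr => i _.
rewrite /clifford raddf_sum; apply: eq_bigr => j _.
by rewrite /= map_mxZ map_mxM map_in_alg [in RHS]mxE.
Qed.

End Stability.

(* Clifford actions as in the statement exist, e.g. for the form sum x_i^2. *)
Section Existence.
Variable C : numClosedFieldType.

Definition clifford_seq k n (g : nat -> 'M[C]_n) : Prop :=
  forall i j, (i < k)%N -> (j < k)%N ->
    g i *m g j + g j *m g i = (2 * (i == j)%:R)%:M.

Local Ltac blk :=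
  rewrite !(@mulmx_block, @add_block_mx, mulmx0, mul0mx, mulmx1, mul1mx, addr0,
    add0r, mulmxN, mulNmx, opprK, mul_scalar_mx, mul_mx_scalar, subrr, addNr).

Lemma clifford_step k n (g : nat -> 'M[C]_n) :
  clifford_seq k g -> exists h : nat -> 'M[C]_(n + n), clifford_seq k.+2 h.
Proof.
move=> gP.
pose D i : 'M[C]_(n + n) := block_mx (g i) 0 0 (- g i).
pose E : 'M[C]_(n + n) := block_mx 0 1%:M 1%:M 0.
pose E' : 'M[C]_(n + n) := block_mx 0 (- 'i%:M) 'i%:M 0.
have two : (2 : C)%:M = block_mx (2%:M : 'M_n) 0 0 (2%:M : 'M_n).
  by rewrite -scalar_mx_block.
have z0 : (0 : C)%:M = block_mx (0 : 'M_n) 0 0 (0 : 'M_n).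
  by rewrite raddf0 block_mx0.
have ii : 'i *: ('i%:M : 'M[C]_n) = - 1%:M.
  by rewrite scale_scalar_mx -expr2 sqrCi raddfN.
have DD i j : (i < k)%N -> (j < k)%N ->
    D i *m D j + D j *m D i = (2 * (i == j)%:R)%:M.
  by move=> ik jk; rewrite /D; blk; rewrite [RHS]scalar_mx_block;
    congr block_mx; apply: gP.
have DE i : D i *m E + E *m D i = 0 by rewrite /D /E; blk; rewrite block_mx0.
have DE' i : D i *m E' + E' *m D i = 0 by rewrite /D /E'; blk; rewrite block_mx0.
have EE' : E *m E' + E' *m E = 0 by rewrite /E /E'; blk; rewrite block_mx0.
have EE : E *m E + E *m E = 2%:M.
  by rewrite /E; blk; rewrite two -raddfD.
have E'E' : E' *m E' + E' *m E' = 2%:M.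
  by rewrite /E'; blk; rewrite two ii opprK -raddfD.
exists (fun i => if (i < k)%N then D i else if i == k then E else E') => i j.
have lt3 l : (l < k.+2)%N -> [\/ (l < k)%N, l = k | l = k.+1].
  rewrite ltnS leq_eqVlt ltnS leq_eqVlt => /or3P[] /= ?;
    by [constructor 3; apply/eqP | constructor 2; apply/eqP | constructor 1].
have k1k : (k.+1 == k) = false by rewrite gtn_eqF.
have kk1 : (k == k.+1) = false by rewrite ltn_eqF.
have k1Nk : (k.+1 < k)%N = false by rewrite ltnNge leqnSn.
have zz : 0 = (2 * false%:R : C)%:M :> 'M_(n + n) by rewrite mulr0 raddf0.
have lt_neq l : (l < k)%N -> ((l == k) = false) * ((k == l) = false) *
    ((l == k.+1) = false) * ((k.+1 == l) = false).
  move=> lk; have lk1 : (l < k.+1)%N by rewrite ltnS ltnW.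
  by rewrite (ltn_eqF lk) (gtn_eqF lk) (ltn_eqF lk1) (gtn_eqF lk1).
move=> /lt3[] hi /lt3[] hj; rewrite ?hi ?hj ?(lt_neq i) ?(lt_neq j) //;
  rewrite ?ltnn ?eqxx ?k1k ?kk1 ?k1Nk ?DD ?EE ?E'E' ?mulr1 //.
all: by rewrite -zz ?DE ?DE' ?EE' // addrC ?DE ?DE' ?EE'.
Qed.
End Existence.

Lemma clifford_action_exists (R : realType) :
  exists gamma : 'I_9 -> 'M[R[i]]_16, clifford_action 1%:M gamma.
Proof.
have [|g2 /clifford_step[g4 /clifford_step[g6 /clifford_step[g8 gP]]]] :=
  @clifford_step R[i] 1 1 (fun=> 1%:M).
  by move=> [] // [] // _ _; rewrite mul1mx mulr1 -raddfD.
by exists (fun i : 'I_9 => g8 i) => i j; rewrite gP // mxE.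
Qed.

(* Main.v *)
From HB Require Import structures.
Require Import Defs.
From mathcomp Require Import all_boot all_order all_algebra.
From mathcomp Require Import boolp classical_sets functions reals complex.
From mathcomp Require Import mpoly.
From mathcomp Require Import ring.

(* Over a field, a spinor delta lies in U . Delta if and only if u u' delta = 0 for
   all u, u' in U.  A general delta is moved by three reflections to (1, 0), in the
   model V = C + O, Delta = O + O with O the split octonions, where this condition
   forces U to lie in O and becomes \bar u u' = 0.  Triality for Spin_8, which is
   U |-> {x : U x = 0} on isotropic planes of O, turns \bar u u' = 0 into
   orthogonality of the new plane to 1, leaving the isotropic planes in the
   seven-dimensional space of imaginary octonions.

   Over an arbitrary algebra a plane is the image of an idempotent P of trace 2;
   that its third exterior power vanishes replaces the choice of a local basis,
   and the projections needed are polynomials in the operator sum u_i w_i, where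
   (u_i) spans U and (w_i) is dual to it. *)

Set Implicit Arguments.
Unset Strict Implicit.
Unset Printing Implicit Defensive.

Import Order.TTheory GRing.Theory Num.Theory.
Local Open Scope ring_scope.

(** An algebra may have nilpotents, so equations over it cannot be checked in residue fields.
    Invertibility can: a vector fixed by a matrix that vanishes in every residue field is zero.
    Vanishing statements about planes are brought to this form; what remains are polynomial
    identities in P.

    The projections come from the Fock picture. Vectors of an isotropic plane U act as creation
    operators, and N = sum u_i w_i counts them, with eigenvalues 0, 1, 2. The condition u u' delta =
    0 removes the eigenvalue 0, so N is invertible on delta and delta lies in U . Delta. The vectors
    killed by U form the eigenspace 2, which in the eight-dimensional module O has rank 2 again.

    The forms and the Clifford action of the theorem are arbitrary and have to be compared with the
    octonion model: nondegenerate forms of one size are congruent, and a module of dimension 16 is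
    determined up to the sign of one vector of V. Generality of (x, y) means that the
    Spin_9-invariant form b(x, x) + b(y, y) and the form b(x, x) are nonzero, which keeps the three
    reflecting vectors nonisotropic. *)

Local Notation "M ^@ A" := (map_mx (in_alg A) M) (at level 2, A at level 1).

(** * Residue fields *)

Section ResidueField.
Local Open Scope quotient_scope.
Variables (A : comNzRingType) (I : idealr A).
Definition maximal_ideal := forall x, x \notin I -> exists y, y * x - 1 \in I.
Hypothesis Imax : maximal_ideal.

(* The field structure depends on the maximality proof, hence the extra argument. *)
Definition residue_of (_ : maximal_ideal) := {ideal_quot I}.
Local Notation residue := (residue_of Imax).
HB.instance Definition _ := GRing.ComNzRing.on residue.

Lemma residue_inv_ex (x : residue) : exists y : residue,
  (x != 0 -> y * x = 1) /\ (x = 0 -> y = 0).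
Proof.
have [->|x0] := eqVneq x 0; first by exists 0.
have /Imax[y yP] : repr x \notin I.
  apply: contraNN x0 => xI; apply/eqP; rewrite -[x](@reprK _ {ideal_quot I}).
  rewrite -[RHS](@reprK _ {ideal_quot I}); apply/eqP.
  rewrite -Quotient.idealrBE rpredB //.
  have : (repr (0 : {ideal_quot I}) - 0) \in I by rewrite Quotient.idealrBE reprK raddf0.
  by rewrite subr0.
exists (\pi_{ideal_quot I} y); split=> [_|xz]; last by rewrite xz eqxx in x0.
rewrite -[x](@reprK _ {ideal_quot I}).
have -> : (\pi_({ideal_quot I}) y : {ideal_quot I}) * \pi_({ideal_quot I}) (repr x)
    = \pi_({ideal_quot I}) (y * repr x) by rewrite rmorphM.
have -> : (1 : {ideal_quot I}) = \pi_({ideal_quot I}) 1 by rewrite rmorph1.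
by apply/eqP; rewrite -Quotient.idealrBE.
Qed.

Definition residue_inv (x : residue) : residue := sval (cid (residue_inv_ex x)).

Fact residue_mulVf x : x != 0 -> residue_inv x * x = 1.
Proof. exact: (svalP (cid (residue_inv_ex x))).1. Qed.

Fact residue_invr0 : residue_inv 0 = 0.
Proof. exact: (svalP (cid (residue_inv_ex 0))).2. Qed.

HB.instance Definition _ :=
  GRing.ComNzRing_isField.Build residue residue_mulVf residue_invr0.

Lemma ideal_residue_field : exists (K : fieldType) (f : {rmorphism A -> K}),
  forall a, a \in I -> f a = 0.
Proof.
exists residue, (\pi_{ideal_quot I} : {rmorphism A -> {ideal_quot I}}) => a aI /=.
apply/eqP; rewrite -[X in _ == X](rmorph0 (\pi_{ideal_quot I})).
by rewrite -Quotient.idealrBE subr0.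
Qed.
End ResidueField.

Section Units.
Local Open Scope classical_set_scope.
Variable A : comNzRingType.

(** The third condition on I says that 1 is not in I + (a), so a maximal I swallows a and is a
    maximal ideal. The empty set has to qualify, being the union of the empty chain; hence the
    alternative x = 0 in [ext]. *)
Lemma nonunit_residue_field (a : A) : (forall b, b * a <> 1) ->
  exists (K : fieldType) (f : {rmorphism A -> K}), f a = 0.
Proof.
move=> aN.
pose P : set (set A) := [set I | [/\ forall x y, I x -> I y -> I (x + y),
  forall c x, I x -> I (c * x) & forall x c, I x -> x + c * a <> 1]].
have [|I [[ID IM Ia] Imax]] := @Zorn_bigcup A P.
  move=> F FP Ftot; split.
  - move=> x y [X FX Xx] [Y FY Yy].
    case: (Ftot _ _ FX FY) => [XY|YX].
      by exists Y => //; have [D _ _] := FP _ FY; apply: D => //; exact: XY.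
    by exists X => //; have [D _ _] := FP _ FX; apply: D => //; exact: YX.
  - by move=> c x [X FX Xx]; exists X => //; have [_ M _] := FP _ FX; apply: M.
  - by move=> x c [X FX Xx]; have [_ _] := FP _ FX; apply.
pose ext b : set A := [set z | exists x c, (I x \/ x = 0) /\ z = x + c * b].
have extD b x y : ext b x -> ext b y -> ext b (x + y).
  move=> [x1 [c [h1 ->]]] [x2 [d [h2 ->]]]; exists (x1 + x2), (c + d).
  rewrite mulrDl addrACA; split=> //.
  case: h1 h2 => [h1|->] [h2|->]; rewrite ?addr0 ?add0r; try by [left|right].
  by left; apply: ID.
have extM b c x : ext b x -> ext b (c * x).
  move=> [x1 [d [h1 ->]]]; exists (c * x1), (c * d); rewrite mulrDr mulrA; split=> //.
  by case: h1 => [h|->]; [left; apply: IM|right; rewrite mulr0].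
have sub_ext b : I `<=` ext b.
  by move=> x Ix; exists x, 0; rewrite mul0r addr0; split=> //; left.
have ext_in b : ext b b by exists 0, 1; rewrite add0r mul1r; split=> //; right.
have maxP b : P (ext b) -> I b.
  move=> Pb; apply: contrapT => Ib; apply: (Imax (ext b)) => //.
  by split=> // /(_ b (ext_in b)).
have Iin : I a.
  apply: maxP; split; [exact: extD|exact: extM|] => z c [x [d [h ->]]].
  rewrite -addrA -mulrDl.
  by case: h => [/Ia|->]; [apply|rewrite add0r; apply: aN].
have I0 : I 0 by rewrite -(mul0r a); apply: IM.
have I1 : ~ I 1 by move=> /(Ia 1 0); rewrite mul0r addr0; apply.
pose pI := [pred x | `[< I x >]].
have pIP : idealr_closed pI.
  split; first by rewrite inE.
    by apply/negP; rewrite inE.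
  by move=> c x y; rewrite !inE => hx hy; apply: ID hy; apply: IM.
pose Im := isIdealr.Build A pI pIP.
pose IJ : idealr A := HB.pack (pI : A -> bool) Im.
have [|K [f fP]] := @ideal_residue_field A IJ; last first.
  by exists K, f; apply: fP; change (is_true `[< I a >]); apply/asboolP.
move=> x xN; have {xN}xI : ~ I x.
  by move=> h; case/negP: xN; change (is_true `[< I x >]); apply/asboolP.
apply: contrapT => nex.
apply: xI; apply: maxP; split; [exact: extD|exact: extM|] => z c [y [d [h ->]]] e.
apply: nex; exists d; change (is_true `[< I (d * x - 1) >]); apply/asboolP.
have -> : d * x - 1 = (- 1) * y + (- c) * a by rewrite -{1}e; ring.
by apply: ID; apply: IM => //; case: h => [//|->].
Qed.

Lemma unit_of_fields (a : A) :
  (forall (K : fieldType) (f : {rmorphism A -> K}), f a != 0) ->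
  exists b, b * a = 1.
Proof.
move=> h; apply: contrapT => nex.
have [|K [f f0]] := @nonunit_residue_field a; first by move=> b e; apply: nex; exists b.
by have := h K f; rewrite f0 eqxx.
Qed.

End Units.

(** * Idempotents of rank two *)

(** In a rank factorisation P = X Y, idempotency forces Y X to be the identity of size the rank. *)
Lemma mxtrace_idempotent (K : fieldType) n (P : 'M[K]_n) :
  P *m P = P -> \tr P = (\rank P)%:R.
Proof.
move=> PP; rewrite -{1}(mulmx_base P) mxtrace_mulC.
suff -> : row_base P *m col_base P = 1%:M by rewrite mxtrace1.
have := mulmx_base P; have := row_free_inj (row_base_free P).
have := row_full_inj (col_base_full P).
move: (col_base P) (row_base P) => X Y Xinj Yinj XY.
by apply/Yinj/Xinj; rewrite /= mul1mx !mulmxA XY -mulmxA XY PP.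
Qed.

Section Idempotents.
Variables (C : numFieldType) (A : comAlgType C).

(** Positive integers are invertible in C, hence in A and in every field under A. *)
Lemma natr_residue_neq0 (K : fieldType) (f : {rmorphism A -> K}) n :
  (n.+1%:R : K) != 0.
Proof.
suff : f ((n.+1%:R^-1 : C)%:A) * n.+1%:R = 1.
  by apply: contra_eq_neq => ->; rewrite mulr0 eq_sym oner_eq0.
rewrite -(rmorph_nat f) -rmorphM /= mulr_natr scalerMnl -mulr_natr.
by rewrite mulVf ?pnatr_eq0 // scale1r rmorph1.
Qed.

Lemma natr_residue_inj (K : fieldType) (f : {rmorphism A -> K}) m n :
  (m%:R : K) = n%:R -> m = n.
Proof.
wlog le_mn : m n / (m <= n)%N.
  by move=> h e; case/orP: (leq_total m n) => l; [exact: h|exact/esym/h].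
move=> /esym/eqP; rewrite -subr_eq0 -natrB //.
case e : (n - m)%N => [|k]; last by rewrite (negPf (natr_residue_neq0 f k)).
by move=> _; apply/eqP; rewrite eqn_leq le_mn -subn_eq0 e.
Qed.

(** The determinant of 1 - Q is 1 in every residue field, hence a unit of A, and 1 - Q is
    invertible. This is how residue fields yield equations in a ring with nilpotents. *)
Lemma row_vanish_of_fields n (v : 'rV[A]_n) (Q : 'M[A]_n) :
  v *m Q = v ->
  (forall (K : fieldType) (f : {rmorphism A -> K}), map_mx f Q = 0) -> v = 0.
Proof.
move=> vQ Q0; have [K f|b bP] := @unit_of_fields A (\det (1%:M - Q)).
  by rewrite -det_map_mx map_mxB map_mx1 Q0 subr0 det1 oner_eq0.
have : v *m (1%:M - Q) *m \adj (1%:M - Q) = 0.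
  by rewrite mulmxBr mulmx1 vQ subrr mul0mx.
rewrite -mulmxA mul_mx_adj mul_mx_scalar => /(congr1 (fun w => b *: w)).
by rewrite scalerA bP scale1r scaler0.
Qed.

Lemma idempotent_vanish_of_fields n (Q : 'M[A]_n) : Q *m Q = Q ->
  (forall (K : fieldType) (f : {rmorphism A -> K}), map_mx f Q = 0) -> Q = 0.
Proof.
move=> QQ Q0; apply/row_matrixP => i; rewrite row0.
by apply: row_vanish_of_fields Q0; rewrite -row_mul QQ.
Qed.

Lemma idempotent_trace0 n (Q : 'M[A]_n) : Q *m Q = Q -> \tr Q = 0 -> Q = 0.
Proof.
move=> QQ tQ; apply: idempotent_vanish_of_fields => // K f.
apply/eqP; rewrite -mxrank_eq0; apply/eqP/(natr_residue_inj f).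
by rewrite -mxtrace_idempotent -?map_mxM ?QQ // trace_map_mx tQ rmorph0.
Qed.

Lemma trace2_rank n (P : 'M[A]_n) : P *m P = P -> \tr P = 2%:R ->
  forall (K : fieldType) (f : {rmorphism A -> K}), \rank (map_mx f P) = 2%N.
Proof.
move=> PP tP K f; apply: (natr_residue_inj f).
by rewrite -mxtrace_idempotent -?map_mxM ?PP // trace_map_mx tP rmorph_nat.
Qed.

Section RankTwo.
Variables (n : nat) (P : 'M[A]_n).

Definition minor3 i j k a b c : A :=
  P i a * (P j b * P k c - P j c * P k b) - P i b * (P j a * P k c - P j c * P k a)
  + P i c * (P j a * P k b - P j b * P k a).

Hypothesis rkP : forall (K : fieldType) (f : {rmorphism A -> K}),
  \rank (map_mx f P) = 2%N.

Lemma minor3_residue (K : fieldType) (f : {rmorphism A -> K}) i j k a b c :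
  f (minor3 i j k a b c) = 0.
Proof.
have [X [Y e]] : exists (X : 'M[K]_(n, 2)) (Y : 'M[K]_(2, n)), map_mx f P = X *m Y.
  by rewrite -(rkP f); exists (col_base (map_mx f P)), (row_base (map_mx f P)); rewrite mulmx_base.
have fP x y : f (P x y) = X x 0 * Y 0 y + X x 1 * Y 1 y.
  by move/matrixP: e => /(_ x y); rewrite !mxE !big_ord_recl big_ord0 addr0; 
    have -> : lift ord0 ord0 = 1 :> 'I_2 by apply/val_inj.
rewrite /minor3 !(rmorphD, rmorphB, rmorphM, rmorphN, fP) /=; ring.
Qed.

Lemma sum3_idx (F : 'I_n -> 'I_n -> 'I_n -> A) :
  \sum_(p < #|{: 'I_n * 'I_n * 'I_n}|)
     F (enum_val p).1.1 (enum_val p).1.2 (enum_val p).2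
  = \sum_a \sum_b \sum_c F a b c.
Proof.
rewrite -(big_enum_val (fun p => F p.1.1 p.1.2 p.2)).
by rewrite pair_bigA /= pair_bigA.
Qed.

(* The antisymmetrised cube of P fixes the row vector t, and it vanishes in
   all residue fields. *)
Lemma alternating3_vanish (t : 'I_n -> 'I_n -> 'I_n -> A) :
  (forall x y z, t y x z = - t x y z) -> (forall x y z, t x z y = - t x y z) ->
  (forall x y z, \sum_a \sum_b \sum_c t a b c * (P a x * P b y * P c z) = t x y z) ->
  forall x y z, t x y z = 0.
Proof.
move=> t12 t23 tP x y z.
pose T := ('I_n * 'I_n * 'I_n)%type.
pose v : 'rV[A]_#|{: T}| := \row_p t (enum_val p).1.1 (enum_val p).1.2 (enum_val p).2.
(* A minor is a signed sum over 3! = 6 permutations, so Q is the cube of P followed by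
   antisymmetrisation. *)
pose Q : 'M[A]_#|{: T}| := \matrix_(p, q) (6%:R^-1 *:
  minor3 (enum_val p).1.1 (enum_val p).1.2 (enum_val p).2
         (enum_val q).1.1 (enum_val q).1.2 (enum_val q).2).
have vQ : v *m Q = v.
  apply/rowP => q; rewrite !mxE; under eq_bigr do rewrite !mxE -scalerAr.
  move: (enum_val q) => [[a b] c] /=.
  rewrite -scaler_sumr (sum3_idx (fun i j k => t i j k * minor3 i j k a b c)).
  have -> : \sum_i \sum_j \sum_k t i j k * minor3 i j k a b c =
    t a b c - t a c b - t b a c + t c a b + t b c a - t c b a.
    rewrite -!tP -!(sumrB, big_split) /=; apply: eq_bigr => i _.
    rewrite -!(sumrB, big_split) /=; apply: eq_bigr => j _.
    rewrite -!(sumrB, big_split) /=; apply: eq_bigr => k _.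
    by rewrite /minor3; ring.
  have e1 := t23 a b c; have e2 := t12 a b c.
  have e3 : t c a b = t a b c by rewrite t12 e1 opprK.
  have e4 : t b c a = t a b c by rewrite t23 e2 opprK.
  have e5 : t c b a = - t a b c by rewrite t12 e4.
  rewrite e1 e2 e3 e4 e5 !opprK -!mulr2n.
  have -> : t a b c *+ 2 + t a b c + t a b c + t a b c + t a b c = 6%:R *: t a b c.
    by rewrite scaler_nat -!mulrSr.
  by rewrite scalerA mulVf ?pnatr_eq0 // scale1r.
have Q0 (K : fieldType) (f : {rmorphism A -> K}) : map_mx f Q = 0.
  apply/matrixP => p q; rewrite !mxE -mulr_algl rmorphM /= minor3_residue.
  by rewrite mulr0.
have /rowP/(_ (enum_rank ((x, y), z))) := row_vanish_of_fields vQ Q0.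
by rewrite !mxE enum_rankK.
Qed.

Hypothesis PP : P *m P = P.

Lemma sum_idem i j : \sum_k P i k * P k j = P i j.
Proof. by rewrite -{3}PP mxE. Qed.

(** Vanishing in fields alone would only make the minor nilpotent. As a function of its columns it
    is alternating and, P being idempotent, fixed by the cube of P, so it is zero. *)
Lemma minor3_eq0 i j k a b c : minor3 i j k a b c = 0.
Proof.
move: a b c; apply: alternating3_vanish; try by move=> a b c; rewrite /minor3; ring.
move=> x y z.
have S (u v w : 'I_n -> A) : \sum_a \sum_b \sum_c u a * v b * w c =
    (\sum_a u a) * (\sum_b v b) * (\sum_c w c).
  rewrite mulr_suml mulr_suml; apply: eq_bigr => a _.
  rewrite [u a * _]mulr_sumr mulr_suml; apply: eq_bigr => b _.
  by rewrite mulr_sumr.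
have S' (s : 'I_n -> 'I_n -> 'I_n -> 'I_n) (i1 i2 i3 : 'I_n) : 
  \sum_a \sum_b \sum_c P i1 a * P i2 b * P i3 c * (P a x * P b y * P c z)
   = P i1 x * P i2 y * P i3 z.
  rewrite -(sum_idem i1) -(sum_idem i2) -(sum_idem i3) -S.
  by do 3!(apply: eq_bigr => ? _); ring.
transitivity (P i x * P j y * P k z - P i x * P k y * P j z - P j x * P i y * P k z
   + P k x * P i y * P j z + P j x * P k y * P i z - P k x * P j y * P i z); last first.
  by rewrite /minor3; ring.
rewrite -!S' //; do 3!(rewrite -!(sumrB, big_split) /=; apply: eq_bigr => ? _).
by rewrite /minor3; ring.
Qed.

(** Contracting the vanishing minors over one, two and three pairs of indices gives (tr P - 2) (tr P
    - 1) tr P = 0. The last two factors are 1 and 2 in every residue field, hence units. *)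
Lemma rank2_trace : \tr P = 2%:R.
Proof.
have [K f|b bP] := @unit_of_fields A (\tr P).
  rewrite -trace_map_mx mxtrace_idempotent ?rkP ?(natr_residue_neq0 f) //.
  by rewrite -map_mxM PP.
have [K f|c cP] := @unit_of_fields A (\tr P - 1).
  rewrite rmorphB /= -trace_map_mx mxtrace_idempotent ?rkP; last by rewrite -map_mxM PP.
  by rewrite rmorph1 -[2%:R](natrD _ 1 1) addrK oner_eq0.
have h1 i j a d : (\tr P - 2%:R) * (P i a * P j d - P i d * P j a) = 0.
  have : \sum_k minor3 i j k a d k = 0 by apply: big1 => k _; apply: minor3_eq0.
  move=> <-; rewrite mulrBl /mxtrace mulr_suml.
  rewrite [RHS](eq_bigr (fun k => P k k * (P i a * P j d - P i d * P j a)
     - P i a * (P j k * P k d) + P i d * (P j k * P k a)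
     + P j a * (P i k * P k d) - P j d * (P i k * P k a))); last first.
    by move=> k _; rewrite /minor3; ring.
  rewrite !(sumrB, big_split) /= -!mulr_sumr !sum_idem; ring.
have h2 i a : (\tr P - 2%:R) * (\tr P - 1) * P i a = 0.
  have : \sum_j (\tr P - 2%:R) * (P i a * P j j - P i j * P j a) = 0.
    by apply: big1 => j _; apply: h1.
  by rewrite -mulr_sumr sumrB -mulr_sumr sum_idem -/(\tr P) => <-; ring.
have h3 : (\tr P - 2%:R) * (\tr P - 1) * \tr P = 0.
  by rewrite mulr_sumr; apply: big1 => i _; apply: h2.
apply/eqP; rewrite -subr_eq0; apply/eqP.
transitivity ((\tr P - 2%:R) * (\tr P - 1) * \tr P * c * b); last by rewrite h3 !mul0r.
transitivity ((\tr P - 2%:R) * (c * (\tr P - 1)) * (b * \tr P)); last by ring.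
by rewrite cP bP !mulr1.
Qed.
End RankTwo.
End Idempotents.

(** Trades the condition on all fields for one equation in A, which can be verified directly for the
    projections built later. *)
Lemma Gr2_trace (R : realType) (A : comAlgType R[i]) m (W : set 'cV[A]_m) :
  Gr 2 W <-> exists P : 'M[A]_m,
    [/\ P *m P = P, W = range (fun u : 'cV[A]_m => P *m u) & \tr P = 2%:R].
Proof.
split=> [[P [PP -> rkP]]|[P [PP -> tP]]]; exists P; split=> //.
  exact: rank2_trace.
exact: trace2_rank.
Qed.

(** * Isotropic planes in Clifford modules *)

(* Locked, since otherwise rewriting with mulmx_sumr unfolds it into a sum. *)
HB.lock Definition cliff (A : comPzRingType) n M N (l : 'I_n -> 'M[A]_(M, N)) (v : 'cV[A]_n) :=
  \sum_(i < n) v i 0 *: l i.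
Canonical cliff_unlockable := Unlockable cliff.unlock.

Section CliffLinear.
Variables (A : comPzRingType) (n M N : nat) (l : 'I_n -> 'M[A]_(M, N)).

Lemma cliff_is_linear : linear (cliff l).
Proof.
move=> a u v; rewrite unlock scaler_sumr -big_split /=; apply: eq_bigr => i _.
by rewrite !mxE scalerDl scalerA.
Qed.
HB.instance Definition _ :=
  GRing.isLinear.Build A 'cV[A]_n 'M[A]_(M, N) _ (cliff l) cliff_is_linear.

Lemma cliff_delta i : cliff l (delta_mx i 0) = l i.
Proof.
rewrite unlock (bigD1 i) //= mxE !eqxx scale1r big1 ?addr0 // => j ji.
by rewrite mxE (negPf ji) scale0r.
Qed.

Lemma cliff_mulmx m (P : 'M[A]_(n, m)) v :
  cliff l (P *m v) = \sum_(a < m) v a 0 *: cliff l (col a P).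
Proof.
have -> : P *m v = \sum_a v a 0 *: col a P.
  apply/colP => i; rewrite mxE summxE; apply: eq_bigr => a _.
  by rewrite !mxE mulrC.
by rewrite linear_sum; apply: eq_bigr => a _; rewrite linearZ.
Qed.
End CliffLinear.

Definition bform (A : comPzRingType) n (B : 'M[A]_n) (v w : 'cV[A]_n) : A :=
  (v^T *m B *m w) 0 0.

Section BilinearForm.
Variables (A : comPzRingType) (n : nat) (B : 'M[A]_n).

Lemma bformDr u v w : bform B u (v + w) = bform B u v + bform B u w.
Proof. by rewrite /bform mulmxDr mxE. Qed.

Lemma bformDl u v w : bform B (u + v) w = bform B u w + bform B v w.
Proof. by rewrite /bform linearD /= !mulmxDl mxE. Qed.

Lemma bformZr a u v : bform B u (a *: v) = a * bform B u v.
Proof. by rewrite /bform -scalemxAr mxE. Qed.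

Lemma bformZl a u v : bform B (a *: u) v = a * bform B u v.
Proof. by rewrite /bform linearZ /= -!scalemxAl mxE. Qed.

Lemma bform_sumr I (r : seq I) u (F : I -> 'cV[A]_n) :
  bform B u (\sum_(i <- r) F i) = \sum_(i <- r) bform B u (F i).
Proof. by rewrite /bform mulmx_sumr summxE. Qed.

Lemma bformC v w : B^T = B -> bform B v w = bform B w v.
Proof.
move=> Bsym; rewrite /bform; have -> : v^T *m B *m w = (w^T *m B *m v)^T.
  by rewrite !trmx_mul trmxK Bsym mulmxA.
by rewrite mxE.
Qed.

Lemma bform_dual Bi v a : B *m Bi = 1%:M -> bform B v (col a Bi) = v a 0.
Proof.
by move=> BBi; rewrite /bform colE mulmxA -[v^T *m B *m Bi]mulmxA BBi mulmx1 -colE !mxE.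
Qed.
End BilinearForm.

Definition inv2 (C : numFieldType) (A : comAlgType C) : A := (2%:R^-1 : C)%:A.

Lemma mul2inv2 (C : numFieldType) (A : comAlgType C) : 2%:R * inv2 A = 1.
Proof. by rewrite mulrC mulr_natr scalerMnl -mulr_natr mulVf ?pnatr_eq0 // scale1r. Qed.

Section IsotropicPlane.
Variables (C : numFieldType) (A : comAlgType C) (n M N : nat).
Variables (B Bi : 'M[A]_n) (P : 'M[A]_n).
Hypotheses (Bsym : B^T = B) (BBi : B *m Bi = 1%:M).
Hypotheses (PP : P *m P = P) (tP : \tr P = 2%:R).
Hypothesis Piso : forall x y, bform B (P *m x) (P *m y) = 0.

(** The n columns of P generate the plane without a choice of basis, and [d] is the basis of the
    whole space dual to the standard one, so the sum of u_a (x) d_a is P viewed as a tensor. *)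
Let u a := col a P.
Let d a := col a Bi.

Lemma mul_proj_col a : P *m u a = u a.
Proof. by rewrite /u !colE mulmxA PP. Qed.

Section Clifford.
(** [l] and [l'] are the two halves of a Clifford action that exchanges two modules, as left
    multiplication by an octonion and by its conjugate. Taking l = l' covers an action on a single
    module. *)
Variables (l : 'I_n -> 'M[A]_(M, N)) (l' : 'I_n -> 'M[A]_(N, M)).
Local Notation L := (cliff l).
Local Notation L' := (cliff l').
Hypothesis LL' : forall v w, L v *m L' w + L w *m L' v = (bform B v w)%:M.
Hypothesis L'L : forall v w, L' v *m L w + L' w *m L v = (bform B v w)%:M.

(* The product is alternating in three vectors, and the module has rank two. *)
Lemma cliff3_col a b c : L (u a) *m L' (u b) *m L (u c) = 0.
Proof.
apply/matrixP => i j; rewrite [RHS]mxE.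
have iso a' b' : bform B (u a') (u b') = 0.
  by rewrite -mul_proj_col -(mul_proj_col b') Piso.
have oppE (X : 'M[A]_(M, N)) : (- X) i j = - X i j by rewrite mxE.
move: a b c; apply: (alternating3_vanish (trace2_rank PP tP)) => x y z.
- have := LL' (u x) (u y); rewrite iso raddf0 => /eqP; rewrite addr_eq0 => /eqP ->.
  by rewrite mulNmx oppE opprK.
- have := L'L (u y) (u z); rewrite iso raddf0 => /eqP; rewrite addr_eq0 => /eqP e.
  by rewrite -!mulmxA e mulmxN oppE opprK.
rewrite -[in RHS](mul_proj_col x) -[in RHS](mul_proj_col y) -[in RHS](mul_proj_col z).
rewrite !cliff_mulmx !mulmx_suml summxE; apply: eq_bigr => a _.
rewrite [X in (X *m _) i j]mulmx_sumr mulmx_suml summxE; apply: eq_bigr => b _.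
rewrite mulmx_sumr summxE; apply: eq_bigr => c _.
by rewrite -?(scalemxAl, scalemxAr) !scalerA mxE !mxE; ring.
Qed.

Lemma cliff3 x y z : L (P *m x) *m L' (P *m y) *m L (P *m z) = 0.
Proof.
rewrite !cliff_mulmx !mulmx_suml; apply: big1 => a _.
rewrite [X in X *m _]mulmx_sumr mulmx_suml; apply: big1 => b _.
rewrite mulmx_sumr; apply: big1 => c _.
by rewrite -?(scalemxAl, scalemxAr) cliff3_col !scaler0.
Qed.

(* The number operator of the Fock space with creation operators the vectors
   of the isotropic module. *)
Definition number_op := \sum_a L' (u a) *m L (d a).

(* The projection (N^2 - N) / 2 onto the top eigenspace of the number operator,
   written in normal order. *)
Definition top_op := - inv2 A *: \sum_a \sum_b L' (u a) *m L (u b) *m (L' (d a) *m L (d b)).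

(** Move d_a past u_b in u_a d_a u_b d_b. The contraction B(d_a, u_b) = P_ab sums back to the number
    operator, and the reordered term is twice [top_op]. *)
Lemma number_op_sqr :
  number_op *m number_op = number_op + 2%:R *: top_op.
Proof.
rewrite /top_op scalerA mulrN mul2inv2 scaleN1r.
apply/eqP; rewrite eq_sym subr_eq eq_sym; apply/eqP.
rewrite /number_op mulmx_suml -big_split /=.
under eq_bigr do rewrite mulmx_sumr -big_split /=.
rewrite exchange_big /=; apply: eq_bigr => b _.
transitivity (\sum_a P a b *: (L' (u a) *m L (d b))); last first.
  rewrite -[in RHS](mul_proj_col b) cliff_mulmx mulmx_suml.
  by apply: eq_bigr => a _; rewrite mxE scalemxAl.
apply: eq_bigr => a _.
rewrite !mulmxA -mulmxDl -!mulmxA -mulmxDr LL' (bformC _ _ Bsym) (bform_dual _ _ BBi) mul_mx_scalar.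
by rewrite !mxE scalemxAl.
Qed.

Definition conumber_op := \sum_a L' (d a) *m L (u a).

(** The anticommutators of u_a and d_a add up to tr P, the rank of the plane. *)
Lemma number_conumber : number_op + conumber_op = 2%:R%:M.
Proof.
rewrite /number_op /conumber_op -big_split /= -tP.
rewrite (eq_bigr (fun a => (P a a)%:M)) ?raddf_sum //.
by move=> a _; rewrite L'L (bform_dual _ _ BBi) !mxE.
Qed.

Lemma cliff_top_op x : L (P *m x) *m top_op = 0.
Proof.
rewrite /top_op -scalemxAr mulmx_sumr big1 ?scaler0 // => a _.
rewrite mulmx_sumr big1 // => b _; rewrite !mulmxA.
by rewrite -(mul_proj_col a) -(mul_proj_col b) cliff3 !mul0mx.
Qed.

(** A vector killed by the plane is killed by [conumber_op], so it has eigenvalue 2 for the number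
    operator N, where (N^2 - N) / 2 is 1. *)
Lemma top_op_id k (X : 'M[A]_(N, k)) :
  (forall a, L (u a) *m X = 0) -> top_op *m X = X.
Proof.
move=> uX.
have nX : number_op *m X = 2%:R *: X.
  have := number_conumber => /(congr1 (fun Z => Z *m X)).
  rewrite mulmxDl mul_scalar_mx [conumber_op *m X]mulmx_suml.
  by rewrite [X in _ + X]big1 ?addr0 // => a _; rewrite -mulmxA uX mulmx0.
have := number_op_sqr => /(congr1 (fun Z => inv2 A *: (Z *m X))).
rewrite mulmxDl -mulmxA nX -scalemxAr nX -scalemxAl scalerDr !scalerA.
rewrite [inv2 A * 2%:R]mulrC mul2inv2 mul1r !scale1r scaler_nat mulr2n.
by move/addrI.
Qed.

Lemma top_op_idem : top_op *m top_op = top_op.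
Proof. by apply: top_op_id => a; rewrite -mul_proj_col cliff_top_op. Qed.

Lemma range_top_op (x : 'cV[A]_N) :
  (forall a, L (u a) *m x = 0) <-> exists y, top_op *m y = x.
Proof.
split=> [/top_op_id e|[y <-] a]; first by exists x.
by rewrite mulmxA -mul_proj_col cliff_top_op mul0mx.
Qed.

(** Exhibits the image of [top_op] as products of vectors of the plane with something, the form to
    which adjunction applies. *)
Lemma top_op_span (x : 'cV[A]_N) : top_op *m x =
  \sum_a L' (u a) *m (- inv2 A *: (\sum_b L (u b) *m (L' (d a) *m L (d b))) *m x).
Proof.
rewrite /top_op scaler_sumr mulmx_suml; apply: eq_bigr => a _.
rewrite mulmxA -scalemxAr mulmx_sumr; congr (mulmx _ _); congr (_ *: _).
by apply: eq_bigr => b _; rewrite -mulmxA.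
Qed.

(** Only the eigenvalues 1 and 2 of the number operator N occur in x, so (N - 1) (N - 2) x = 0, that
    is, x = N (3 - N) x / 2. In terms of M = 2 - N, which is [conumber_op], the relation reads M^2 x
    = M x. *)
Lemma number_op_span (x : 'cV[A]_N) : (forall a b, L' (u a) *m L (u b) *m x = 0) ->
  x = \sum_a L' (u a) *m (inv2 A *: (L (d a) *m (3%:R *: x - number_op *m x))).
Proof.
move=> ux.
have sq : conumber_op *m (conumber_op *m x) = conumber_op *m x.
  rewrite /conumber_op !mulmx_suml; apply: eq_bigr => a _; rewrite mulmx_sumr.
  transitivity (\sum_b P b a *: (L' (d a) *m (L (u b) *m x))).
    apply: eq_bigr => b _.
    transitivity (L' (d a) *m (L (u a) *m L' (d b)) *m (L (u b) *m x)).
      by rewrite !mulmxA.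
    have -> : L (u a) *m L' (d b) = (P b a)%:M - L (d b) *m L' (u a).
      by apply/eqP; rewrite -subr_eq opprK LL' (bform_dual _ _ BBi) mxE.
    rewrite mulmxBr mulmxBl mul_mx_scalar -scalemxAl.
    have -> : L' (d a) *m (L (d b) *m L' (u a)) *m (L (u b) *m x) =
      L' (d a) *m L (d b) *m (L' (u a) *m L (u b) *m x) by rewrite !mulmxA.
    by rewrite ux mulmx0 subr0.
  rewrite -[in RHS](mul_proj_col a) cliff_mulmx mulmx_sumr mulmx_suml.
  by apply: eq_bigr => b _; rewrite -scalemxAr -scalemxAl mxE mulmxA.
have nE : number_op = 2%:R%:M - conumber_op by rewrite -number_conumber addrK.
have e2 : number_op *m (3%:R *: x - number_op *m x) = 2%:R *: x.
  have -> : 3%:R *: x - number_op *m x = x + conumber_op *m x.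
    rewrite nE mulmxBl mul_scalar_mx; move: (conumber_op *m x) => y.
    by apply/colP => i; rewrite !mxE; ring.
  rewrite nE mulmxDr !mulmxBl sq !mul_scalar_mx; move: (conumber_op *m x) => y.
  by apply/colP => i; rewrite !mxE; ring.
transitivity (inv2 A *: (2%:R *: x)); first by rewrite scalerA mulrC mul2inv2 scale1r.
rewrite -e2 mulmx_suml scaler_sumr.
by apply: eq_bigr => a _; rewrite -scalemxAr mulmxA.
Qed.

(** The trace of four Clifford vectors on a module of rank 8: each pairing contributes B / 2, whence
    the constant 8 / 4 = 2. *)
Hypothesis trace4 : forall v w v' w', \tr (L' v *m L w *m (L' v' *m L w')) =
  2%:R * (bform B v w * bform B v' w' - bform B v v' * bform B w w'
          + bform B v w' * bform B w v').

(** Isotropy kills the first of the three pairings. The other two give (tr P)^2 - tr P, which is 2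
    again: this is why triality takes planes to planes. *)
Lemma top_op_trace : \tr top_op = 2%:R.
Proof.
rewrite /top_op linearZ /= linear_sum /=.
under eq_bigr do rewrite linear_sum /=.
have iso a' b' : bform B (u a') (u b') = 0.
  by rewrite -mul_proj_col -(mul_proj_col b') Piso.
have -> : \sum_a \sum_b \tr (L' (u a) *m L (u b) *m (L' (d a) *m L (d b))) =
    - 2%:R * \sum_a (\tr P * P a a - P a a).
  rewrite mulr_sumr; apply: eq_bigr => a _.
  transitivity (- 2%:R * \sum_b (P b b * P a a - P a b * P b a)); last first.
    by rewrite sumrB -mulr_suml (sum_idem PP).
  rewrite mulr_sumr; apply: eq_bigr => b _.
  rewrite trace4 iso mul0r !(bform_dual _ _ BBi) !mxE; ring.
rewrite sumrB -mulr_sumr -/(\tr P) tP.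
transitivity (2%:R * inv2 A * 2%:R); first by ring.
by rewrite mul2inv2 mul1r.
Qed.
End Clifford.
End IsotropicPlane.

Lemma eq_mulmx_col (A : comPzRingType) m n (X Y : 'M[A]_(m, n)) :
  (forall v : 'cV_n, X *m v = Y *m v) -> X = Y.
Proof.
move=> XY; apply/matrixP => i j; have /colP/(_ i) := XY (delta_mx j 0).
by rewrite -!colE !mxE.
Qed.

Section IsotropicPlanes.
Local Open Scope classical_set_scope.
Variables (C : numFieldType) (A : comAlgType C).

(* The A-points of OG(2, n), with the rank condition expressed by the trace. *)
Definition isoplane n (B : 'M[A]_n) (W : set 'cV[A]_n) : Prop :=
  exists P : 'M[A]_n, [/\ P *m P = P, W = range (mulmx P : 'cV_n -> 'cV_n),
    \tr P = 2%:R & forall x y, W x -> W y -> bform B x y = 0].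

(** The difference P' - P P' is an idempotent projecting onto a complement of W in W', and its trace
    is 2 - 2 = 0. *)
Lemma isoplane_sub_eq n (B B' : 'M[A]_n) (W W' : set 'cV[A]_n) :
  isoplane B W -> isoplane B' W' -> W `<=` W' -> W = W'.
Proof.
move=> [P [PP -> tP _]] [P' [PP' -> tP' _]] sub; apply/seteqP; split=> // _ [x _ <-].
have P'P : P' *m P = P.
  apply: eq_mulmx_col => v; have [|y _ yP] := sub (P *m v); first by exists v.
  by rewrite -mulmxA -yP mulmxA PP'.
have E : P' - P *m P' = 0.
  apply: (@idempotent_trace0 C A); last by rewrite linearB /= mxtrace_mulC P'P tP tP' subrr.
  rewrite !(mulmxBl, mulmxBr) PP' -[P *m P' *m P']mulmxA PP' mulmxA P'P.
  by rewrite [P *m P' *m _]mulmxA -[P *m P' *m P]mulmxA P'P PP subrr subr0.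
exists (P' *m x) => //; rewrite mulmxA.
by move/eqP: E; rewrite subr_eq0 => /eqP <-.
Qed.

(** The projection J P J' is idempotent as soon as J' J is the identity on W, so J may relate spaces
    of different dimension. *)
Lemma isoplane_linear m n (B : 'M[A]_m) (B' : 'M[A]_n)
    (J : 'M[A]_(n, m)) (J' : 'M[A]_(m, n)) (W : set 'cV[A]_m) :
  isoplane B W -> (forall w, W w -> J' *m (J *m w) = w) ->
  (forall x y, W x -> W y -> bform B x y = 0 -> bform B' (J *m x) (J *m y) = 0) ->
  isoplane B' (mulmx J @` W).
Proof.
move=> [P [PP WP tP Wiso]] J'J JB.
have J'JP : J' *m (J *m P) = P.
  by apply: eq_mulmx_col => v; rewrite -!mulmxA J'J // WP; exists v.
exists (J *m P *m J'); split.
- have e : J' *m (J *m (P *m J')) = P *m J'.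
    by rewrite !mulmxA -(mulmxA J' J P) J'JP.
  by rewrite -!mulmxA e (mulmxA P P) PP.
- apply/seteqP; split=> [_ [w Ww <-]|_ [x _ <-]].
    exists (J *m w) => //=; rewrite -!mulmxA J'J //.
    by move: Ww; rewrite WP => -[x _ <-]; rewrite (mulmxA P P) PP.
  by exists (P *m J' *m x); rewrite ?mulmxA // WP; exists (J' *m x); rewrite ?mulmxA.
- by rewrite mxtrace_mulC J'JP.
- by move=> _ _ [x Wx <-] [y Wy <-]; apply: JB => //; apply: Wiso.
Qed.

Lemma isoplaneZ n (B : 'M[A]_n) (a b : A) (W : set 'cV[A]_n) :
  b * a = 1 -> isoplane (a *: B) W <-> isoplane B W.
Proof.
move=> ba; have bE x y : bform (a *: B) x y = a * bform B x y.
  by rewrite /bform -scalemxAr -scalemxAl mxE.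
split=> -[P [PP WP tP Wi]]; exists P; split=> // x y Wx Wy.
  by rewrite -[LHS]mul1r -ba -mulrA -bE Wi ?mulr0.
by rewrite bE Wi ?mulr0.
Qed.

Definition annihilator n M N (l : 'I_n -> 'M[A]_(M, N)) (W : set 'cV[A]_n) : set 'cV[A]_N :=
  [set x | forall u, W u -> cliff l u *m x = 0].

Section Annihilator.
Variables (n : nat) (B Bi : 'M[A]_n) (l l' : 'I_n -> 'M[A]_n).
Local Notation L := (cliff l).
Local Notation L' := (cliff l').
Hypotheses (Bsym : B^T = B) (BBi : B *m Bi = 1%:M).
Hypothesis LL' : forall v w, L v *m L' w + L w *m L' v = (bform B v w)%:M.
Hypothesis L'L : forall v w, L' v *m L w + L' w *m L v = (bform B v w)%:M.
Hypothesis adjoint : forall u x y, bform B x (L' u *m y) = bform B (L u *m x) y.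

Lemma mulmx_bform W P : W = range (mulmx P : 'cV_n -> 'cV_n) ->
  (forall x y, W x -> W y -> bform B x y = 0) ->
  forall x y, bform B (P *m x) (P *m y) = 0.
Proof. by move=> -> h x y; apply: h; [exists x|exists y]. Qed.

Lemma annihilator_range W P : P *m P = P -> W = range (mulmx P : 'cV_n -> 'cV_n) ->
  \tr P = 2%:R -> (forall x y, W x -> W y -> bform B x y = 0) ->
  annihilator l W = range (mulmx (top_op Bi P l l') : 'cV_n -> 'cV_n).
Proof.
move=> PP WP tP Wi; have Pi := mulmx_bform WP Wi.
have rg x := range_top_op Bsym BBi PP tP Pi LL' L'L x.
apply/seteqP; split=> [x xW|_ [y _ <-]].
  have [|y <-] := (rg x).1; last by exists y.
  by move=> a; apply: xW; rewrite WP -(mul_proj_col PP); exists (col a P).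
move=> u; rewrite WP => -[z _ <-]; rewrite cliff_mulmx mulmx_suml big1 // => a _.
by rewrite -scalemxAl ((rg _).2 _ a) ?scaler0 //; exists y.
Qed.

Hypothesis trace4 : forall v w v' w', \tr (L' v *m L w *m (L' v' *m L w')) =
  2%:R * (bform B v w * bform B v' w' - bform B v v' * bform B w w'
          + bform B v w' * bform B w v').

(** For isotropy, write one of two annihilated vectors as a sum of L' u z with u in W and move L' u
    to the other vector, where it becomes L u and gives 0. *)
Lemma annihilator_isoplane W : isoplane B W -> isoplane B (annihilator l W).
Proof.
move=> [P [PP WP tP Wi]]; have Pi := mulmx_bform WP Wi.
have rgW := annihilator_range PP WP tP Wi.
exists (top_op Bi P l l'); split=> //.
- exact: (top_op_idem Bsym BBi PP tP Pi LL' L'L).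
- exact: (top_op_trace BBi PP tP Pi trace4).
move=> x y xW yW; move: (yW); rewrite {1}rgW => -[z _ <-].
rewrite top_op_span bform_sumr big1 // => a _.
by rewrite adjoint xW ?/bform ?linear0 ?mul0mx ?mxE // WP -(mul_proj_col PP); exists (col a P).
Qed.

(** The annihilator is generated by the products L' u (L v z) with u, v in W. Adjunction moves both
    factors onto o, and z is arbitrary, so nondegeneracy of B concludes. *)
Lemma annihilator_orthogonal W o : isoplane B W ->
  (forall x, annihilator l W x -> bform B o x = 0) <->
  (forall u v, W u -> W v -> L' u *m (L v *m o) = 0).
Proof.
move=> [P [PP WP tP Wi]]; have Pi := mulmx_bform WP Wi.
have bC x y : bform B x y = bform B y x by apply: bformC.
have W_col a : W (col a P) by rewrite WP -(mul_proj_col PP); exists (col a P).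
split=> [h u v Wu Wv|h x].
  apply/colP => a; rewrite -(bform_dual _ _ BBi) [RHS]mxE bC adjoint bC -adjoint.
  apply: h => w; move: Wu Wv; rewrite WP => -[x _ <-] [y _ <-] [z _ <-].
  by rewrite !mulmxA (cliff3 PP tP Pi LL' L'L) mul0mx.
rewrite (annihilator_range PP WP tP Wi) => -[z _ <-].
rewrite top_op_span bform_sumr big1 // => a _.
rewrite adjoint -scalemxAl bformZr mulmx_suml bform_sumr big1 ?mulr0 // => b _.
by rewrite -!mulmxA bC -adjoint h // /bform mulmx0 mxE.
Qed.
End Annihilator.
End IsotropicPlanes.

(** * Split octonions *)

Section BilinearExtension.
Variables (A : comPzRingType) (n : nat) (B : 'M[A]_n).

Lemma bformE v w : bform B v w = \sum_a \sum_b v a 0 * w b 0 * B a b.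
Proof.
rewrite /bform mxE; under eq_bigr do rewrite mxE mulr_suml.
rewrite exchange_big /=; apply: eq_bigr => a _; apply: eq_bigr => b _.
by rewrite mxE; ring.
Qed.

Lemma cliff_mul_sum M N Q (l' : 'I_n -> 'M[A]_(M, N)) (l : 'I_n -> 'M[A]_(N, Q)) v w :
  cliff l' v *m cliff l w = \sum_a \sum_b (v a 0 * w b 0) *: (l' a *m l b).
Proof.
rewrite unlock mulmx_suml; apply: eq_bigr => a _.
rewrite mulmx_sumr; apply: eq_bigr => b _.
by rewrite -scalemxAl -scalemxAr scalerA.
Qed.

Lemma cliff_anticomm M N (l : 'I_n -> 'M[A]_(M, N)) (l' : 'I_n -> 'M[A]_(N, M)) :
  (forall a b, l' a *m l b + l' b *m l a = (B a b)%:M) ->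
  forall v w, cliff l' v *m cliff l w + cliff l' w *m cliff l v = (bform B v w)%:M.
Proof.
move=> h v w; rewrite !cliff_mul_sum [X in _ + X]exchange_big -big_split /=.
rewrite bformE raddf_sum; apply: eq_bigr => a _.
rewrite -big_split raddf_sum; apply: eq_bigr => b _ /=.
by rewrite [w b 0 * _]mulrC -scalerDr h scale_scalar_mx.
Qed.

Lemma cliff_adjoint (l l' : 'I_n -> 'M[A]_n) :
  (forall a, B *m l' a = (l a)^T *m B) ->
  forall u x y, bform B x (cliff l' u *m y) = bform B (cliff l u *m x) y.
Proof.
move=> h u x y; rewrite /bform; congr (_ _ _); rewrite trmx_mul -!mulmxA; congr mulmx.
rewrite !mulmxA; congr (_ *m y); rewrite unlock mulmx_sumr linear_sum mulmx_suml.
apply: eq_bigr => a _; rewrite -scalemxAr h.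
by rewrite scalemxAl; congr (_ *m B); apply/matrixP => i j; rewrite !mxE.
Qed.

Lemma cliff_trace4 M N (l : 'I_n -> 'M[A]_(M, N)) (l' : 'I_n -> 'M[A]_(N, M)) :
  (forall a b c d, \tr (l' a *m l b *m (l' c *m l d)) =
     2%:R * (B a b * B c d - B a c * B b d + B a d * B b c)) ->
  forall v w v' w', \tr (cliff l' v *m cliff l w *m (cliff l' v' *m cliff l w')) =
  2%:R * (bform B v w * bform B v' w' - bform B v v' * bform B w w'
          + bform B v w' * bform B w v').
Proof.
move=> h v w v' w'; rewrite !cliff_mul_sum mulmx_suml raddf_sum /=.
have S (s t x y : 'cV[A]_n) : bform B s t * bform B x y =
  \sum_a \sum_b \sum_c \sum_d s a 0 * t b 0 * x c 0 * y d 0 * (B a b * B c d).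
  rewrite !bformE mulr_suml; apply: eq_bigr => a _.
  rewrite mulr_suml; apply: eq_bigr => b _.
  rewrite mulr_sumr; apply: eq_bigr => c _.
  by rewrite mulr_sumr; apply: eq_bigr => d _; ring.
rewrite !S.
(* Permute the sums so that all three products of forms run over the same quadruples of basis
   vectors as the trace. *)
rewrite [X in _ - X + _](eq_bigr (fun a => \sum_c \sum_b \sum_d
  v a 0 * v' b 0 * w c 0 * w' d 0 * (B a b * B c d))); last first.
  by move=> a _; rewrite exchange_big.
rewrite [X in _ - _ + X](eq_bigr (fun a => \sum_c \sum_d \sum_b
  v a 0 * w' b 0 * w c 0 * v' d 0 * (B a b * B c d))); last first.
  by move=> a _; rewrite exchange_big /=; apply: eq_bigr => c _; rewrite exchange_big.
rewrite -sumrB -big_split mulr_sumr; apply: eq_bigr => a _ /=.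
rewrite mulmx_suml raddf_sum -sumrB -big_split mulr_sumr; apply: eq_bigr => b _ /=.
rewrite mulmx_sumr raddf_sum -sumrB -big_split mulr_sumr; apply: eq_bigr => c _ /=.
rewrite mulmx_sumr raddf_sum -sumrB -big_split mulr_sumr; apply: eq_bigr => d _ /=.
by rewrite -scalemxAl -scalemxAr !mxtraceZ h; ring.
Qed.

End BilinearExtension.

(* Split octonions as Zorn vector matrices, basis e_0, ..., e_7 with e_0 + e_7 = 1:
   the integer +-(k + 1) encodes +-e_k, and 0 encodes 0. *)
Definition oct_table : seq (seq int) :=
  [:: [:: 1; 2; 3; 4; 0; 0; 0; 0];
      [:: 0; 0; 7; -6; 1; 0; 0; 2];
      [:: 0; -7; 0; 5; 0; 1; 0; 3];
      [:: 0; 6; -5; 0; 0; 0; 1; 4];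
      [:: 5; 8; 0; 0; 0; -4; 3; 0];
      [:: 6; 0; 8; 0; 4; 0; -2; 0];
      [:: 7; 0; 0; 8; -3; 2; 0; 0];
      [:: 0; 0; 0; 0; 5; 6; 7; 8]].

Definition oct_code (a b : nat) : int := nth 0 (nth [::] oct_table a) b.

Definition oct_conj (a : nat) : int :=
  if a == 0%N then 8 else if a == 7%N then 1 else - (a.+1)%:Z.

(** Linear extension to signed codes. Codes suffice since a product of two basis octonions is 0 or
    plus or minus a basis octonion. *)
Definition lift_code (t : nat -> int) (z : int) : int :=
  match z with Posz 0 => 0 | Posz k.+1 => t k | Negz k => - t k end.

Definition coef (z : int) (i : nat) : int := lift_code (fun k => (k == i)%:Z) z.

(* Codes of the images of e_j under left and right multiplication by e_a and by
   its conjugate. *)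
Definition octL a j := oct_code a j.
Definition octL' a j := lift_code (fun b => oct_code b j) (oct_conj a).
Definition octR a j := oct_code j a.
Definition octR' a j := lift_code (oct_code j) (oct_conj a).

(** The octonion \bar e_a e_b + \bar e_b e_a is a multiple of 1 = e_0 + e_7, so its coefficient at
    e_0 is the value of the polar form of the norm. *)
Definition octB a b : int := coef (octL' a b) 0 + coef (octL' b a) 0.

Definition all8 (p : pred nat) := all p (iota 0 8).

Lemma all8P (p : pred nat) : all8 p -> forall i : 'I_8, p i.
Proof. by move=> /allP h i; apply: h; rewrite mem_iota add0n /=. Qed.

Definition code_ok (t : nat -> nat -> int) :=
  all8 (fun a => all8 (fun j => (`|t a j| <= 8)%N)).

Definition anticomm_ok (t' t : nat -> nat -> int) :=
  all8 (fun a => all8 (fun b => all8 (fun j => all8 (fun i =>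
    coef (lift_code (t' a) (t b j)) i + coef (lift_code (t' b) (t a j)) i
    == octB a b * (i == j)%:Z)))).

Definition adjoint_ok (t' t : nat -> nat -> int) :=
  all8 (fun a => all8 (fun j => all8 (fun i =>
    lift_code (octB i) (t' a j) == lift_code (fun k => octB k j) (t a i)))).

Definition trace4_ok (t' t : nat -> nat -> int) :=
  all8 (fun a => all8 (fun b => all8 (fun c => all8 (fun d =>
    foldr (fun j s => coef (lift_code (t' a) (lift_code (t b) (lift_code (t' c) (t d j)))) j + s)
      0 (iota 0 8)
    == 2 * (octB a b * octB c d - octB a c * octB b d + octB a d * octB b c))))).

(** The identities are multilinear with integer coefficients: checking basis vectors over the
    integers proves them over every ring. The last one says that the Gram matrix is its own inverse,
    so its columns are the dual basis. *)
Lemma octonion_ok :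
  [/\ [&& code_ok octL, code_ok octL', code_ok octR & code_ok octR'],
      [&& anticomm_ok octL' octL, anticomm_ok octL octL', anticomm_ok octR' octR
        & anticomm_ok octR octR'],
      [&& adjoint_ok octL' octL & adjoint_ok octR' octR],
      [&& trace4_ok octL' octL & trace4_ok octR' octR] &
      all8 (fun i => all8 (fun j => (octB i j == octB j i) &&
        (foldr (fun k s => octB i k * octB k j + s) 0 (iota 0 8) == (i == j)%:Z)))].
Proof. by split; vm_compute. Qed.

Lemma all8_2P (p : nat -> nat -> bool) :
  all8 (fun a => all8 (p a)) -> forall a b : 'I_8, p a b.
Proof. by move=> h a b; apply: (all8P (p := p a)); apply: (all8P h a). Qed.

Lemma all8_3P (p : nat -> nat -> nat -> bool) :
  all8 (fun a => all8 (fun b => all8 (p a b))) -> forall a b c : 'I_8, p a b c.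
Proof. by move=> h a b c; apply: (all8P (p := p a b)); apply: (all8_2P h a b). Qed.

Lemma all8_4P (p : nat -> nat -> nat -> nat -> bool) :
  all8 (fun a => all8 (fun b => all8 (fun c => all8 (p a b c)))) ->
  forall a b c d : 'I_8, p a b c d.
Proof. by move=> h a b c d; apply: (all8P (p := p a b c)); apply: (all8_3P h a b c). Qed.

Section OctonionMatrices.
Variable A : comPzRingType.

Definition code_vec (z : int) : 'cV[A]_8 := \col_i (coef z i)%:~R.

Definition code_mx (t : nat -> int) : 'M[A]_8 := \matrix_(i, j) (coef (t j) i)%:~R.

Definition oct_mx (T : nat -> nat -> int) (a : 'I_8) : 'M[A]_8 := code_mx (T a).

Definition octB_mx : 'M[A]_8 := \matrix_(i, j) (octB i j)%:~R.

Lemma sum_lift_code (t : nat -> A) z : (`|z| <= 8)%N ->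
  \sum_(k < 8) t k * (coef z k)%:~R =
  match z with Posz 0 => 0 | Posz k.+1 => t k | Negz k => - t k end.
Proof.
case: z => [[|k]|k] /= hz.
- by apply: big1 => k _; rewrite mulr0.
- rewrite (bigD1 (Ordinal hz)) //= /coef /= eqxx mulr1 big1 ?addr0 // => j.
  by rewrite -val_eqE /= eq_sym => /negPf ->; rewrite mulr0.
- rewrite (bigD1 (Ordinal hz)) //= /coef /= eqxx mulrN1 big1 ?addr0 // => j.
  by rewrite -val_eqE /= eq_sym => /negPf ->; rewrite oppr0 mulr0.
Qed.

Lemma code_mx_vec t z : (`|z| <= 8)%N -> code_mx t *m code_vec z = code_vec (lift_code t z).
Proof.
move=> hz; apply/colP => i; rewrite !mxE; under eq_bigr do rewrite !mxE.
rewrite (sum_lift_code (fun k => (coef (t k) i)%:~R)) //.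
case: z hz => [[|k]|k] //= _; rewrite -rmorphN /coef.
by case: (t k) => [[|m]|m] //=; rewrite ?oppr0 ?opprK.
Qed.

Lemma code_mxM t (u : nat -> int) : (forall j : 'I_8, (`|u j| <= 8)%N) ->
  code_mx t *m code_mx u = code_mx (fun j => lift_code t (u j)).
Proof.
move=> hu; apply/matrixP => i j; have /colP/(_ i) := code_mx_vec t (hu j).
by rewrite !mxE => <-; apply: eq_bigr => k _; rewrite !mxE.
Qed.

Lemma code_okP T : code_ok T -> forall a j : 'I_8, (`|T a j| <= 8)%N.
Proof. exact: (@all8_2P (fun a j => `|T a j| <= 8)%N). Qed.

Lemma oct_anticomm T' T : code_ok T -> anticomm_ok T' T -> forall a b,
  oct_mx T' a *m oct_mx T b + oct_mx T' b *m oct_mx T a = (octB_mx a b)%:M.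
Proof.
move=> /code_okP ok; rewrite /anticomm_ok => /all8_4P h a b.
rewrite !code_mxM; [|exact: ok|exact: ok].
have /= {}h := h a b; apply/matrixP => i j.
rewrite !mxE -intrD (eqP (h j i)) intrM val_eqE.
by case: (i == j); rewrite ?mulr1 ?mulr0.
Qed.

Lemma oct_adjoint T' T : code_ok T -> code_ok T' -> adjoint_ok T' T -> forall a,
  octB_mx *m oct_mx T' a = (oct_mx T a)^T *m octB_mx.
Proof.
move=> /code_okP ok /code_okP ok'; rewrite /adjoint_ok => /all8_3P h a.
have liftE (t : nat -> int) z : (`|z| <= 8)%N ->
    \sum_(k < 8) (t k)%:~R * (coef z k)%:~R = (lift_code t z)%:~R :> A.
  move=> hz; rewrite (sum_lift_code (fun k => (t k)%:~R)) //.
  by case: z hz => [[|k]|k] //= _; rewrite rmorphN.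
apply/matrixP => i j; rewrite !mxE.
under eq_bigr do rewrite !mxE; under [RHS]eq_bigr do rewrite !mxE mulrC.
rewrite (liftE (octB i)) // (liftE (fun k => octB k j)) //.
by rewrite (eqP (h a j i)).
Qed.

Lemma lift_code_le T (a : 'I_8) z : code_ok T -> (`|z| <= 8)%N -> (`|lift_code (T a) z| <= 8)%N.
Proof.
move=> /code_okP ok; case: z => [[|k]|k] //= hk; last rewrite abszN.
  exact: (ok a (Ordinal hk)).
exact: (ok a (Ordinal hk)).
Qed.

Lemma oct_trace4 T' T : code_ok T -> code_ok T' -> trace4_ok T' T -> forall a b c d,
  \tr (oct_mx T' a *m oct_mx T b *m (oct_mx T' c *m oct_mx T d)) =
  2%:R * (octB_mx a b * octB_mx c d - octB_mx a c * octB_mx b d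
          + octB_mx a d * octB_mx b c).
Proof.
move=> ok ok'; rewrite /trace4_ok => /all8_4P h a b c d; rewrite -mulmxA.
rewrite (@code_mxM (T' c)) => [|j]; last exact: code_okP.
rewrite (@code_mxM (T b)) => [|j]; last exact/lift_code_le/code_okP.
rewrite (@code_mxM (T' a)) => [|j]; last exact/lift_code_le/lift_code_le/code_okP.
have {}h := eqP (h a b c d).
rewrite !mxE -!intrM -intrB -intrD -(intrM _ 2) -h.
rewrite /mxtrace; under eq_bigr do rewrite mxE.
pose F j := coef (lift_code (T' a) (lift_code (T b) (lift_code (T' c) (T d j)))) j.
rewrite -(big_mkord xpredT (fun j => (F j)%:~R : A)) unlock /=.
by rewrite !intrD.
Qed.

Lemma octB_sym : octB_mx^T = octB_mx.
Proof.
have [_ _ _ _ /all8_2P h] := octonion_ok; apply/matrixP => i j; rewrite !mxE.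
by have /andP[/eqP ->] := h i j.
Qed.

Lemma octB_inv : octB_mx *m octB_mx = 1%:M.
Proof.
have [_ _ _ _ /all8_2P h] := octonion_ok; apply/matrixP => i j; rewrite !mxE.
under eq_bigr do rewrite !mxE -intrM.
have /andP[_ /eqP {}h] := h i j.
rewrite -(big_mkord xpredT (fun k => (octB i k * octB k j)%:~R : A)) unlock /=.
transitivity ((val i == val j)%:Z%:~R : A); last by rewrite val_eqE; case: (i == j).
by rewrite -h /= !intrD.
Qed.

Definition octone : 'cV[A]_8 := delta_mx (inord 0) 0 + delta_mx (inord 7) 0.
End OctonionMatrices.

Section OctonionTriality.
Variable A : comPzRingType.
Local Notation L := (cliff (oct_mx A octL)).
Local Notation L' := (cliff (oct_mx A octL')).
Local Notation R := (cliff (oct_mx A octR)).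

(** Both sides are the octonion product v x. This symmetry makes the annihilators for left and right
    multiplication inverse to each other. *)
Lemma octLR v x : L v *m x = R x *m v.
Proof.
rewrite unlock !mulmx_suml.
under eq_bigr do rewrite -scalemxAl; under [RHS]eq_bigr do rewrite -scalemxAl.
apply/colP => i; rewrite !summxE.
under eq_bigr do rewrite !mxE mulr_sumr; under [RHS]eq_bigr do rewrite !mxE mulr_sumr.
rewrite exchange_big; apply: eq_bigr => a _; apply: eq_bigr => b _.
by rewrite !mxE; ring.
Qed.

Lemma octL_one v : L v *m octone A = v.
Proof.
rewrite unlock mulmx_suml [RHS]matrix_sum_delta; apply: eq_bigr => a _.
rewrite big_ord1 -scalemxAl; congr (_ *: _).
rewrite mulmxDr -!colE; apply/colP => i.
rewrite !mxE !inordK // -intrD andbT -val_eqE.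
case: a => a; case: i => i /=.
do 8?[case: i => [|i] //=]; do 8?[case: a => [|a] //=].
Qed.
End OctonionTriality.

(** * Natural isomorphisms, and the zero locus as a condition on pairs of vectors *)

Section Functors.
Local Open Scope classical_set_scope.
Variable R : realType.
Local Notation C := R[i].

Lemma isomorphic_trans m n p (X : submod_functor R m) (Y : submod_functor R n)
    (Z : submod_functor R p) : isomorphic X Y -> isomorphic Y Z -> isomorphic X Z.
Proof.
move=> [phi [bphi nphi]] [psi [bpsi npsi]].
exists (fun A W => psi A (phi A W)); split=> [A|A B f W XW].
  exact: set_bij_comp.
by rewrite nphi // npsi //; have [XY _ _] := bphi A; apply: XY.
Qed.

Lemma isomorphic_inverse m n (X : submod_functor R m) (Y : submod_functor R n)
  (phi : forall A : comAlgType C, set 'cV[A]_m -> set 'cV[A]_n)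
  (psi : forall A : comAlgType C, set 'cV[A]_n -> set 'cV[A]_m) :
  (forall A W, X A W -> Y A (phi A W) /\ psi A (phi A W) = W) ->
  (forall A W, Y A W -> X A (psi A W) /\ phi A (psi A W) = W) ->
  (forall (A B : comAlgType C) (f : {lrmorphism A -> B}) W,
    X A W -> phi B (base_change f W) = base_change f (phi A W)) ->
  isomorphic X Y.
Proof.
move=> XY YX nat; exists phi; split=> // A; split.
- by move=> W /XY[].
- move=> W W' /set_mem/XY[_ e] /set_mem/XY[_ e'] eq; by rewrite -e eq e'.
- by move=> W /YX[XW e]; exists (psi A W).
Qed.

Lemma base_change_range (A B : comAlgType C) (f : {lrmorphism A -> B}) n (P : 'M[A]_n) :
  base_change f (range (mulmx P : 'cV_n -> 'cV_n)) =
  range (mulmx (map_mx f P) : 'cV_n -> 'cV_n).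
Proof.
apply/seteqP; split=> [v [r [b [w [wP ->]]]]|_ [u _ <-]].
  have /choice[x xP] : forall i, exists x, P *m x = w i.
    by move=> i; have [x _ <-] := wP i; exists x.
  exists (\sum_(i < r) b i *: map_mx f (x i)) => //.
  rewrite mulmx_sumr; apply: eq_bigr => i _.
  by rewrite -scalemxAr -map_mxM xP.
exists n, (fun i => u i 0), (fun i => P *m delta_mx i 0); split=> [i|].
  by exists (delta_mx i 0).
rewrite {1}[u]matrix_sum_delta mulmx_sumr; apply: eq_bigr => i _.
by rewrite big_ord1 -scalemxAr map_mxM map_delta_mx.
Qed.

Lemma base_change_linear (A B : comAlgType C) (f : {lrmorphism A -> B}) m n
    (J : 'M[C]_(n, m)) (W : set 'cV[A]_m) :
  mulmx (J ^@ B) @` base_change f W = base_change f (mulmx (J ^@ A) @` W).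
Proof.
have fJ (x : 'cV[A]_m) : map_mx f (J ^@ A *m x) = J ^@ B *m map_mx f x.
  by rewrite map_mxM map_in_alg.
apply/seteqP; split=> [_ [_ [r [b [w [Ww ->]]]] <-]|_ [r [b [w [Ww ->]]]]].
  exists r, b, (fun i => J ^@ A *m w i); split=> [i|]; first by exists (w i).
  by rewrite mulmx_sumr; apply: eq_bigr => i _; rewrite -scalemxAr fJ.
have /choice[x xP] : forall i, exists x, W x /\ J ^@ A *m x = w i.
  by move=> i; have [x Wx <-] := Ww i; exists x.
exists (\sum_(i < r) b i *: map_mx f (x i)).
  by exists r, b, x; split=> // i; case: (xP i).
rewrite mulmx_sumr; apply: eq_bigr => i _.
by rewrite -scalemxAr -fJ (xP i).2.
Qed.

(** Naturality is automatic, because matrices over C commute with base change. J and J' have to be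
    inverse only on the members of X and Y, so m and n may differ. *)
Lemma isomorphic_linear m n (X : submod_functor R m) (Y : submod_functor R n)
    (J : 'M[C]_(n, m)) (J' : 'M[C]_(m, n)) :
  (forall A W, X A W -> Y A (mulmx (J ^@ A) @` W) /\
     forall w, W w -> J' ^@ A *m (J ^@ A *m w) = w) ->
  (forall A W, Y A W -> X A (mulmx (J' ^@ A) @` W) /\
     forall w, W w -> J ^@ A *m (J' ^@ A *m w) = w) ->
  isomorphic X Y.
Proof.
have imK p q (A : comAlgType C) (K : 'M[A]_(p, q)) (K' : 'M[A]_(q, p)) (W : set 'cV[A]_q) :
    (forall w, W w -> K' *m (K *m w) = w) ->
    (mulmx K' : 'cV_p -> 'cV_q) @` ((mulmx K : 'cV_q -> 'cV_p) @` W) = W.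
  move=> h; apply/seteqP; split=> [_ [_ [w Ww <-] <-]|w Ww]; first by rewrite h.
  by exists (K *m w); [exists w|apply: h].
move=> XY YX.
apply: (@isomorphic_inverse _ _ _ _ (fun A W => mulmx (J ^@ A) @` W)
  (fun A W => mulmx (J' ^@ A) @` W)) => [A W /XY[? h]|A W /YX[? h]|A B f W _].
- by split=> //; apply: imK.
- by split=> //; apply: imK.
- exact: base_change_linear.
Qed.

Lemma OG2_isoplane (A : comAlgType C) m (G : 'M[C]_m) (W : set 'cV[A]_m) :
  G^T = G -> OG 2 G W <-> isoplane (G ^@ A) W.
Proof.
move=> Gsym; have GAsym : (G ^@ A)^T = G ^@ A by rewrite map_trmx Gsym.
split=> [[/Gr2_trace[P [PP WP tP]] Wi]|[P [PP WP tP Wi]]]; last first.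
  by split=> [|w Ww]; [apply/Gr2_trace; exists P|apply: Wi].
exists P; split=> // x y Wx Wy.
have WD : W (x + y).
  by move: Wx Wy; rewrite WP => -[u _ <-] [v _ <-]; exists (u + v); rewrite ?mulmxDr.
have q0 w : W w -> bform (G ^@ A) w w = 0 by apply: Wi.
have := q0 _ WD; rewrite bformDl !bformDr (q0 x) // (q0 y) // addr0 add0r.
rewrite (bformC y x) // -mulr2n -mulr_natl => /(congr1 (fun z => inv2 A * z)).
by rewrite mulr0 mulrA [inv2 A * _]mulrC mul2inv2 mul1r.
Qed.

Lemma cliffordE (A : comAlgType C) m N (gamma : 'I_m -> 'M[C]_N) (v : 'cV[A]_m) d :
  clifford gamma v d = cliff (fun i => (gamma i) ^@ A) v *m d.
Proof.
by rewrite /clifford cliff.unlock mulmx_suml; apply: eq_bigr => i _; rewrite scalemxAl.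
Qed.

(** Three vectors of an isotropic plane multiply to zero, which gives one direction; the number
    operator gives the other. The form is doubled because v . v = q(v) makes 2 G the
    anticommutator. *)
Lemma zero_locusE (A : comAlgType C) m N (G : 'M[C]_m) (gamma : 'I_m -> 'M[C]_N) delta
    (W : set 'cV[A]_m) :
  nondegenerate_form G -> clifford_action G gamma ->
  zero_locus 2 G gamma delta W <-> isoplane ((2%:R *: G) ^@ A) W /\
    forall u v, W u -> W v -> cliff (fun i => (gamma i) ^@ A) u *m
      (cliff (fun i => (gamma i) ^@ A) v *m delta ^@ A) = 0.
Proof.
move=> [Gsym Gunit] hg; set g := fun i => (gamma i) ^@ A; set B := (2%:R *: G) ^@ A.
have BE : B = 2%:R *: G ^@ A by rewrite /B map_mxZ rmorph_nat.
have -> : isoplane B W = OG 2 G W.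
  apply/propext; rewrite OG2_isoplane // BE.
  by apply: (@isoplaneZ _ _ _ _ _ (inv2 A)); rewrite mulrC mul2inv2.
have Bsym : B^T = B by rewrite /B map_trmx linearZ /= Gsym.
pose Bi := (2%:R^-1 *: invmx G) ^@ A.
have BBi : B *m Bi = 1%:M.
  rewrite -map_mxM -scalemxAr -scalemxAl scalerA mulVf ?pnatr_eq0 // scale1r.
  by rewrite mulmxV // map_mx1.
have gg v w : cliff g v *m cliff g w + cliff g w *m cliff g v = (bform B v w)%:M.
  apply: cliff_anticomm => a b; rewrite -!map_mxM -map_mxD hg /= map_scalar_mx.
  by rewrite /B !mxE.
split=> -[OGW h]; split=> //; move: (OGW); rewrite OG2_isoplane // => -[P [PP WP tP Wi]].
  have Pi : forall x y, bform B (P *m x) (P *m y) = 0.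
    apply: (mulmx_bform WP) => x y Wx Wy.
    by rewrite BE /bform -scalemxAr -scalemxAl mxE [X in _ * X]Wi ?mulr0.
  have [r [u [d [Wu ->]]]] := h => x y; rewrite WP => -[x' _ <-] [y' _ <-].
  rewrite !mulmx_sumr big1 // => i _; rewrite cliffordE.
  have := Wu i; rewrite WP => -[z _ <-].
  by rewrite !mulmxA (cliff3 PP tP Pi gg gg) mul0mx.
have Wcol a : W (col a P) by rewrite WP -(mul_proj_col PP); exists (col a P).
rewrite /clifford_image /=.
exists m, (fun a => col a P), (fun a => inv2 A *: (cliff g (col a Bi) *m
  (3%:R *: delta ^@ A - number_op Bi P g g *m delta ^@ A))); split=> //.
under eq_bigr do rewrite cliffordE.
apply: (number_op_span BBi PP tP gg gg) => a b.
by rewrite -mulmxA h.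
Qed.
End Functors.

(** * The zero locus of the standard spinor *)

Section OctonionForm.
Variable A : comPzRingType.
Local Notation L := (cliff (oct_mx A octL)).
Local Notation L' := (cliff (oct_mx A octL')).
Local Notation R := (cliff (oct_mx A octR)).
Local Notation R' := (cliff (oct_mx A octR')).
Local Notation b := (bform (octB_mx A)).

Lemma octL'L v w : L' v *m L w + L' w *m L v = (b v w)%:M.
Proof.
have [/and4P[? ? ? ?] /and4P[? ? ? ?] _ _ _] := octonion_ok.
by apply: cliff_anticomm; apply: oct_anticomm.
Qed.

Lemma octLL' v w : L v *m L' w + L w *m L' v = (b v w)%:M.
Proof.
have [/and4P[? ? ? ?] /and4P[? ? ? ?] _ _ _] := octonion_ok.
by apply: cliff_anticomm; apply: oct_anticomm.
Qed.

Lemma octR'R v w : R' v *m R w + R' w *m R v = (b v w)%:M.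
Proof.
have [/and4P[? ? ? ?] /and4P[? ? ? ?] _ _ _] := octonion_ok.
by apply: cliff_anticomm; apply: oct_anticomm.
Qed.

Lemma octRR' v w : R v *m R' w + R w *m R' v = (b v w)%:M.
Proof.
have [/and4P[? ? ? ?] /and4P[? ? ? ?] _ _ _] := octonion_ok.
by apply: cliff_anticomm; apply: oct_anticomm.
Qed.

Lemma octL_adjoint u x y : b x (L' u *m y) = b (L u *m x) y.
Proof.
have [/and4P[? ? ? ?] _ /andP[? ?] _ _] := octonion_ok.
by apply: cliff_adjoint; apply: oct_adjoint.
Qed.

Lemma octR_adjoint u x y : b x (R' u *m y) = b (R u *m x) y.
Proof.
have [/and4P[? ? ? ?] _ /andP[? ?] _ _] := octonion_ok.
by apply: cliff_adjoint; apply: oct_adjoint.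
Qed.

Lemma octL_trace4 v w v' w' : \tr (L' v *m L w *m (L' v' *m L w')) =
  2%:R * (b v w * b v' w' - b v v' * b w w' + b v w' * b w v').
Proof.
have [/and4P[? ? ? ?] _ _ /andP[? ?] _] := octonion_ok.
by apply: cliff_trace4; apply: oct_trace4.
Qed.

Lemma octR_trace4 v w v' w' : \tr (R' v *m R w *m (R' v' *m R w')) =
  2%:R * (b v w * b v' w' - b v v' * b w w' + b v w' * b w v').
Proof.
have [/and4P[? ? ? ?] _ _ /andP[? ?] _] := octonion_ok.
by apply: cliff_trace4; apply: oct_trace4.
Qed.

Lemma bform_octone w : b (octone A) w = w (inord 0) 0 + w (inord 7) 0.
Proof.
rewrite (bformC _ _ (octB_sym A)).
suff -> : octone A = col (inord 0) (octB_mx A) + col (inord 7) (octB_mx A).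
  by rewrite bformDr !(bform_dual _ _ (octB_inv A)).
have h : all8 (fun i => (i == 0)%:Z + (i == 7)%:Z == octB i 0 + octB i 7) by vm_compute.
apply/colP => i; rewrite !mxE !inordK // !andbT -!val_eqE /= !inordK // -intrD.
have /= /eqP <- := all8P h i.
by rewrite intrD; do 2!case: (_ == _).
Qed.

(* The vector (c, v) acts on O + O by (x, y) |-> (c x + \bar v y, v x - c y). *)
Definition spin9 (i : 'I_(1 + 8)) : 'M[A]_(8 + 8) :=
  match @fintype.split 1 8 i with
  | inl _ => block_mx 1%:M 0 0 (- 1%:M)
  | inr a => block_mx 0 (oct_mx A octL' a) (oct_mx A octL a) 0
  end.

(** The polar form of c^2 + \bar v v, that is, twice its Gram matrix. *)
Definition spin9_form : 'M[A]_(1 + 8) := block_mx 2%:M 0 0 (octB_mx A).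

Lemma cliff_spin9 (c : 'cV[A]_1) (v : 'cV[A]_8) :
  cliff spin9 (col_mx c v) =
  block_mx (c 0 0)%:M (L' v) (L v) (- (c 0 0)%:M).
Proof.
have inlE i : spin9 (lshift 8 i) = block_mx 1%:M 0 0 (- 1%:M).
  by rewrite /spin9 (unsplitK (inl _ i)).
have inrE i : spin9 (rshift 1 i) =
    block_mx 0 (oct_mx A octL' i) (oct_mx A octL i) 0.
  by rewrite /spin9 (unsplitK (inr _ i)).
rewrite cliff.unlock big_split_ord big_ord1 /=.
rewrite inlE col_mxEu scale_block_mx scale_scalar_mx mulr1 !scaler0 scalerN scale_scalar_mx mulr1.
have -> : \sum_(i < 8) col_mx c v (rshift 1 i) 0 *: spin9 (rshift 1 i) =
  block_mx 0 (\sum_(i < 8) v i 0 *: oct_mx A octL' i)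
    (\sum_(i < 8) v i 0 *: oct_mx A octL i) 0.
  apply: (big_ind3 (fun X Y Z => X = block_mx 0 Y Z 0)).
  - by rewrite block_mx0.
  - by move=> ? ? ? ? ? ? -> ->; rewrite add_block_mx !addr0.
  - by move=> i _; rewrite inrE col_mxEd scale_block_mx !scaler0.
by rewrite add_block_mx !addr0 !add0r.
Qed.

Lemma bform_spin9_col (a : 'cV[A]_1) x (c : 'cV[A]_1) y :
  bform spin9_form (col_mx a x) (col_mx c y) = 2%:R * a 0 0 * c 0 0 + b x y.
Proof.
rewrite /bform tr_col_mx /spin9_form mul_row_block mul_row_col !mulmx0 addr0 add0r.
by rewrite mxE [X in X + _]mxE big_ord1 mul_mx_scalar !mxE.
Qed.

Lemma spin9_anticomm v w : cliff spin9 v *m cliff spin9 w + cliff spin9 w *m cliff spin9 v =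
  (bform spin9_form v w)%:M.
Proof.
rewrite -[v]vsubmxK -[w]vsubmxK.
move: (usubmx v) (dsubmx v) (usubmx w) (dsubmx w).
move=> a x b y; rewrite !cliff_spin9 !mulmx_block add_block_mx.
rewrite bform_spin9_col.
rewrite [RHS](@scalar_mx_block _ 8 8) !(mulNmx, mulmxN) -!scalar_mxM !mul_scalar_mx !mul_mx_scalar.
congr block_mx.
- by rewrite addrACA octL'L -!raddfD; congr _%:M; ring.
- by rewrite addrA subrK subrr.
- by rewrite addrA subrK subrr.
- by rewrite !opprK addrACA octLL' -!raddfD; congr _%:M; ring.
Qed.

Lemma spin9_octone (a : 'cV[A]_1) x (b : 'cV[A]_1) y :
  cliff spin9 (col_mx a x) *m (cliff spin9 (col_mx b y) *m col_mx (octone A) 0) =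
  col_mx ((a 0 0 * b 0 0) *: octone A + L' x *m y) (b 0 0 *: x - a 0 0 *: y).
Proof.
rewrite !cliff_spin9 !mul_block_col !mulmx0 !addr0 !mul_scalar_mx octL_one.
by rewrite -scalemxAr octL_one scalerA mulNmx mul_scalar_mx.
Qed.

Lemma spin9_form_sym : spin9_form^T = spin9_form.
Proof. by rewrite /spin9_form tr_block_mx tr_scalar_mx !trmx0 octB_sym. Qed.

Lemma bform_spin9 (x y : 'cV[A]_8) :
  bform spin9_form (col_mx 0 x) (col_mx 0 y) = bform (octB_mx A) x y.
Proof. by rewrite bform_spin9_col !mxE !mulr0 add0r. Qed.

Lemma bform_delta n (B : 'M[A]_n) i j : bform B (delta_mx i 0) (delta_mx j 0) = B i j.
Proof. by rewrite /bform -colE trmx_delta -rowE !mxE. Qed.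
End OctonionForm.

Section BaseChange.
Variables (A B : comPzRingType) (f : {rmorphism A -> B}).

Lemma map_oct_mx T a : map_mx f (oct_mx A T a) = oct_mx B T a.
Proof. by apply/matrixP => i j; rewrite !mxE rmorph_int. Qed.

Lemma map_octB_mx : map_mx f (octB_mx A) = octB_mx B.
Proof. by apply/matrixP => i j; rewrite !mxE rmorph_int. Qed.

Lemma map_octone : map_mx f (octone A) = octone B.
Proof. by rewrite map_mxD !map_delta_mx. Qed.

Lemma map_spin9 i : map_mx f (spin9 A i) = spin9 B i.
Proof.
rewrite /spin9; case: fintype.split => a;
  by rewrite map_block_mx !(map_mxN, map_mx1, map_mx0, map_oct_mx).
Qed.

Lemma map_spin9_form : map_mx f (spin9_form A) = spin9_form B.
Proof. by rewrite map_block_mx map_scalar_mx rmorph_nat !map_mx0 map_octB_mx. Qed.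
End BaseChange.

Section ModelZeroLocus.
Local Open Scope classical_set_scope.
Variable R : realType.
Local Notation C := R[i].

Definition oct_null : submod_functor R 8 := fun A U =>
  isoplane (octB_mx A) U /\
  forall u v, U u -> U v -> cliff (oct_mx A octL') u *m v = 0.

Definition spin9_gram : 'M[C]_9 := 2%:R^-1 *: spin9_form C.

Lemma spin9_gram_nondegenerate : nondegenerate_form spin9_gram.
Proof.
split; first by rewrite linearZ /= spin9_form_sym.
rewrite unitmxZ ?unitfE ?invr_eq0 ?pnatr_eq0 //.
suff /mulmx1_unit[] : spin9_form C *m block_mx (2%:R^-1)%:M 0 0 (octB_mx C) = 1%:M by [].
rewrite mulmx_block !mulmx0 !mul0mx !addr0 add0r octB_inv -scalar_mxM mulfV ?pnatr_eq0 //.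
by rewrite -scalar_mx_block.
Qed.

Lemma spin9_action : @clifford_action R 9 16 spin9_gram (spin9 C).
Proof.
move=> i j; have := spin9_anticomm (delta_mx i 0 : 'cV[C]_(1 + 8)) (delta_mx j 0).
rewrite !cliff_delta bform_delta => ->; congr _%:M.
by rewrite [spin9_gram i j]mxE mulrA mulfV ?mul1r ?pnatr_eq0.
Qed.

Definition spin9_vector : 'cV[C]_16 := col_mx (octone C) 0 : 'cV_(8 + 8).

Lemma spin9_zero_locusE (A : comAlgType C) (W : set 'cV[A]_(1 + 8)) :
  @zero_locus R 2 9 16 spin9_gram (spin9 C) spin9_vector A W <->
  isoplane (spin9_form A) W /\ forall u v, W u -> W v ->
    cliff (spin9 A) u *m (cliff (spin9 A) v *m col_mx (octone A) 0) = 0.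
Proof.
have := @zero_locusE R A 9 16 spin9_gram (spin9 C) spin9_vector W
   spin9_gram_nondegenerate spin9_action.
have -> : (2%:R *: spin9_gram) ^@ A = spin9_form A.
  by rewrite scalerA mulfV ?pnatr_eq0 // scale1r map_spin9_form.
have -> : (fun i => (spin9 C i) ^@ A) = spin9 A by apply/funext => i; apply: map_spin9.
have -> : spin9_vector ^@ A = col_mx (octone A) 0 :> 'cV_(8 + 8).
  by apply: etrans (@map_col_mx _ _ (in_alg A) 8 8 1 _ _) _; rewrite map_octone map_mx0.
by [].
Qed.

(** The O-component of u v (1, 0) = 0 gives v_0 u = u_0 v for u, v in W. Comparing w with the i-th
    column of P at entry i and summing over i yields w_0 tr P = (P w)_0 = w_0; as tr P = 2, w_0 =
    0. *)
Lemma spin9_locus_vector (A : comAlgType C) (W : set 'cV[A]_(1 + 8)) w :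
  @zero_locus R 2 9 16 spin9_gram (spin9 C) spin9_vector A W -> W w -> usubmx w = 0.
Proof.
move=> /spin9_zero_locusE[[P [PP WP tP Wi]] kill] Ww.
pose e0 : 'I_(1 + 8) := lshift 8 0.
have rel u v : W u -> W v -> v e0 0 *: u = u e0 0 *: v.
  move=> Wu Wv; have := kill _ _ Wu Wv.
  rewrite -[u]vsubmxK -[v]vsubmxK spin9_octone /e0 !col_mxEu -col_mx0 => /eq_col_mx[_].
  move/eqP; rewrite subr_eq0 => /eqP e.
  rewrite !scale_col_mx e; congr col_mx; apply/colP => i.
  by rewrite !ord1 !mxE mulrC.
have a0 : w e0 0 = 0.
  have : w e0 0 * \tr P = w e0 0.
    rewrite mulr_sumr; transitivity ((P *m w) e0 0); last first.
      by move: Ww; rewrite WP => -[x _ <-]; rewrite mulmxA PP.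
    rewrite mxE; apply: eq_bigr => i _.
    have Wi' : W (col i P) by rewrite WP -(mul_proj_col PP); exists (col i P).
    by have /colP/(_ i) := rel _ _ Wi' Ww; rewrite !mxE.
  by rewrite tP mulr2n mulrDr mulr1 => /eqP; rewrite -subr_eq0 addrK => /eqP.
by apply/colP => i; rewrite !ord1 !mxE.
Qed.

Lemma spin9_zero_locus :
  isomorphic (@zero_locus R 2 9 16 spin9_gram (spin9 C) spin9_vector) oct_null.
Proof.
pose J : 'M[C]_(8, 1 + 8) := row_mx 0 1%:M.
pose J' : 'M[C]_(1 + 8, 8) := col_mx 0 1%:M.
have JE (A : comAlgType C) (c : 'cV_1) (v : 'cV_8) : J ^@ A *m col_mx c v = v.
  by rewrite map_row_mx map_mx0 map_mx1 mul_row_col mul0mx mul1mx add0r.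
have J'E (A : comAlgType C) (v : 'cV_8) : J' ^@ A *m v = col_mx 0 v.
  by rewrite map_col_mx map_mx0 map_mx1 mul_col_mx mul0mx mul1mx.
apply: (@isomorphic_linear R (1 + 8)%N 8
  (@zero_locus R 2 9 16 spin9_gram (spin9 C) spin9_vector) _ J J') => A W hW.
  have us := @spin9_locus_vector A W _ hW.
  have wE w : W w -> col_mx 0 (dsubmx w) = w.
    by move=> Ww; rewrite -[RHS]vsubmxK us.
  have J'J w : W w -> J' ^@ A *m (J ^@ A *m w) = w.
    by move=> Ww; rewrite -{1}(wE w Ww) JE J'E wE.
  split=> //; move/spin9_zero_locusE: hW => [pW kill]; split.
    apply: (isoplane_linear (J' := J' ^@ A) pW J'J) => x y Wx Wy.
    by rewrite -(wE x) // -(wE y) // !JE bform_spin9.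
  move=> _ _ [u Wu <-] [v Wv <-]; have := kill _ _ Wu Wv.
  rewrite -(wE u) // -(wE v) // !JE spin9_octone !mxE mulr0 !scale0r add0r.
  by rewrite -col_mx0 => /eq_col_mx[].
case: hW => [pW kill]; split; last by move=> w _; rewrite J'E JE.
apply/spin9_zero_locusE; split.
  apply: (isoplane_linear (J' := J ^@ A) pW) => [w _|x y _ _].
    by rewrite J'E JE.
  by rewrite !J'E bform_spin9.
move=> _ _ [u Wu <-] [v Wv <-].
by rewrite !J'E spin9_octone kill // !mxE mulr0 !scale0r subrr addr0 col_mx0.
Qed.

(* U |-> {x : U x = 0} is triality between isotropic planes of O as a vector
   and as a half-spin representation. *)
Definition oct_orthogonal : submod_functor R 8 := fun A W =>
  isoplane (octB_mx A) W /\ forall x, W x -> bform (octB_mx A) (octone A) x = 0.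

End ModelZeroLocus.

Lemma map_cliff (A B : comPzRingType) (f : {rmorphism A -> B}) n M N
    (l : 'I_n -> 'M[A]_(M, N)) v :
  map_mx f (cliff l v) = cliff (fun i => map_mx f (l i)) (map_mx f v).
Proof.
rewrite cliff.unlock map_mx_sum; apply: eq_bigr => i _.
by rewrite map_mxZ mxE.
Qed.

Section TopOpBaseChange.
Variables (C : numFieldType) (A B : comAlgType C) (f : {lrmorphism A -> B}) (n M N : nat).
Variables (l : 'I_n -> 'M[A]_(M, N)) (l' : 'I_n -> 'M[A]_(N, M)).

Lemma map_top_op Bi P : map_mx f (top_op Bi P l l') =
  top_op (map_mx f Bi) (map_mx f P) (fun i => map_mx f (l i)) (fun i => map_mx f (l' i)).
Proof.
rewrite /top_op map_mxZ rmorphN /= /inv2 linearZ /= rmorph1; congr (_ *: _).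
rewrite map_mx_sum; apply: eq_bigr => a _.
rewrite map_mx_sum; apply: eq_bigr => b _.
by rewrite !map_mxM !map_cliff !map_col.
Qed.
End TopOpBaseChange.

(** * Triality on isotropic planes of octonions *)

Section Triality.
Local Open Scope classical_set_scope.
Variable R : realType.
Local Notation C := R[i].

(** Kernels do not commute with base change in general, but this annihilator is the image of
    [top_op], which is a universal polynomial expression in P. *)
Lemma base_change_annihilator (A B : comAlgType C) (f : {lrmorphism A -> B}) U :
  isoplane (octB_mx A) U ->
  annihilator (oct_mx B octL) (base_change f U) =
  base_change f (annihilator (oct_mx A octL) U).
Proof.
move=> [P [PP UP tP Ui]].
rewrite (annihilator_range (octB_sym A) (octB_inv A) (@octLL' A) (@octL'L A) PP UP tP Ui).
have mapL T : (fun i => map_mx f (oct_mx A T i)) = oct_mx B T.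
  by apply/funext => i; apply: map_oct_mx.
rewrite base_change_range map_top_op !mapL map_octB_mx.
apply: (annihilator_range (octB_sym B) (octB_inv B) (@octLL' B) (@octL'L B)).
- by rewrite -map_mxM PP.
- by rewrite UP base_change_range.
- by rewrite trace_map_mx tP rmorph_nat.
have Pi := mulmx_bform UP Ui.
rewrite UP base_change_range => _ _ [x _ <-] [y _ <-].
(* Isotropy as a matrix equation over A, which f carries to B. *)
have PBP : P^T *m octB_mx A *m P = 0.
  apply/matrixP => i j; have := Pi (delta_mx i 0) (delta_mx j 0).
  by rewrite /bform trmx_mul !mulmxA -colE -mulmxA trmx_delta -!mulmxA -rowE !mulmxA !mxE.
have := congr1 (map_mx f) PBP; rewrite !map_mxM map_octB_mx -map_trmx map_mx0 => e.
rewrite /bform trmx_mul.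
transitivity ((x^T *m ((map_mx f P)^T *m octB_mx B *m map_mx f P) *m y) 0 0).
  by rewrite !mulmxA.
by rewrite e mulmx0 mul0mx mxE.
Qed.

(** U lies in the annihilator of its annihilator because the product u x is linear in both factors,
    and an inclusion of planes is an equality. Orthogonality to 1 matches the condition on U because
    v 1 = v. *)
Lemma triality_isomorphic : isomorphic (@oct_null R) (@oct_orthogonal R).
Proof.
have annL (A : comAlgType C) := @annihilator_isoplane _ A _ _ _ _ _ (octB_sym A) (octB_inv A)
  (@octLL' A) (@octL'L A) (@octL_adjoint A) (@octL_trace4 A).
have annR (A : comAlgType C) := @annihilator_isoplane _ A _ _ _ _ _ (octB_sym A) (octB_inv A)
  (@octRR' A) (@octR'R A) (@octR_adjoint A) (@octR_trace4 A).
have orth (A : comAlgType C) U := @annihilator_orthogonal _ A _ _ _ _ _ (octB_sym A) (octB_inv A)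
  (@octLL' A) (@octL'L A) (@octL_adjoint A) U (octone A).
have LR (A : comAlgType C) U : isoplane (octB_mx A) U ->
    annihilator (oct_mx A octR) (annihilator (oct_mx A octL) U) = U.
  move=> hU; apply/esym; apply: isoplane_sub_eq (hU) (annR _ _ (annL _ _ hU)) _.
  by move=> u Uu x hx; rewrite -octLR hx.
have RL (A : comAlgType C) U : isoplane (octB_mx A) U ->
    annihilator (oct_mx A octL) (annihilator (oct_mx A octR) U) = U.
  move=> hU; apply/esym; apply: isoplane_sub_eq (hU) (annL _ _ (annR _ _ hU)) _.
  by move=> u Uu x hx; rewrite octLR hx.
apply: (@isomorphic_inverse R _ _ _ _ (fun A U => annihilator (oct_mx A octL) U)
  (fun A U => annihilator (oct_mx A octR) U)) => [A U [pU kill]|A U [pU h]|A B f U [pU _]].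
- split; last exact: LR.
  split; first exact: annL.
  by apply/orth => // u v Uu Uv; rewrite octL_one kill.
- split; last exact: RL.
  split; first exact: annR.
  move=> u v hu hv; rewrite -[v]octL_one; apply: (orth A _ (annR _ _ pU)).1 => // x.
  by rewrite RL //; apply: h.
- exact: base_change_annihilator.
Qed.

End Triality.

(** * Imaginary octonions as a seven-dimensional quadratic space *)

Section Imaginary.
Variable A : comPzRingType.

(** Since b(1, w) = w_0 + w_7, an imaginary octonion is given by its first seven coordinates, the
    last one being minus the first. *)
Definition imaginary_incl : 'M[A]_(8, 7) :=
  (col_mx 1%:M (- delta_mx 0 (inord 0)) : 'M_(7 + 1, 7)).

Definition imaginary_proj : 'M[A]_(7, 8) := (row_mx 1%:M 0 : 'M_(7, 7 + 1)).
Local Notation J := imaginary_incl.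
Local Notation J' := imaginary_proj.

Lemma imaginary_inclE (y : 'cV[A]_7) : J *m y = col_mx y (- row (inord 0) y) :> 'cV_(7 + 1).
Proof.
by rewrite [LHS](@mul_col_mx _ 7 1 7 1) mul1mx mulNmx rowE.
Qed.

Lemma octone_imaginary (y : 'cV[A]_7) : bform (octB_mx A) (octone A) (J *m y) = 0.
Proof.
rewrite bform_octone imaginary_inclE.
have e0 : inord 0 = lshift 1 (inord 0 : 'I_7) :> 'I_8 by apply/val_inj; rewrite /= !inordK.
have e7 : inord 7 = rshift 7 (0 : 'I_1) :> 'I_8 by apply/val_inj; rewrite /= !inordK.
by rewrite e0 e7 (@col_mxEu _ 7 1) (@col_mxEd _ 7 1) !mxE subrr.
Qed.

Lemma imaginary_inclK : J' *m J = 1%:M.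
Proof. by rewrite [LHS](@mul_row_col _ 7 7 1 7) mul1mx mul0mx addr0. Qed.

Lemma imaginary_projK (w : 'cV[A]_8) :
  bform (octB_mx A) (octone A) w = 0 -> J *m (J' *m w) = w.
Proof.
rewrite bform_octone => /eqP; rewrite addr_eq0 => /eqP w07.
have -> : J' *m w = @usubmx _ 7 1 1 w.
  by rewrite -{1}[w](@vsubmxK _ 7 1) [LHS](@mul_row_col _ 7 7 1 1) mul1mx mul0mx addr0.
rewrite imaginary_inclE -[RHS](@vsubmxK _ 7 1); apply: (congr1 (@col_mx _ 7 1 1 _)).
apply/colP => i; rewrite !mxE ord1.
have -> : lshift 1 (inord 0 : 'I_7) = inord 0 :> 'I_8 by apply/val_inj; rewrite /= !inordK.
have -> : rshift 7 (0 : 'I_1) = inord 7 :> 'I_8 by apply/val_inj; rewrite /= !inordK.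
by rewrite w07 opprK.
Qed.

Definition imaginary_gram : 'M[A]_7 := J^T *m octB_mx A *m J.

Lemma bform_imaginary (x y : 'cV[A]_7) :
  bform (octB_mx A) (J *m x) (J *m y) = bform imaginary_gram x y.
Proof. by rewrite /bform trmx_mul !mulmxA. Qed.

Lemma imaginary_gram_sym : imaginary_gram^T = imaginary_gram.
Proof. by rewrite !trmx_mul trmxK octB_sym mulmxA. Qed.

(* The inverse is the Gram matrix of the dual form: with the orthogonal
   projection Q onto the complement of 1, it is J' Q B J'^T. *)
Lemma imaginary_gram_inv (h : A) : 2%:R * h = 1 ->
  exists K, imaginary_gram *m K = 1%:M.
Proof.
move=> h2; pose B := octB_mx A; pose o := octone A.
pose Q : 'M_8 := 1%:M - h *: (o *m (o^T *m B)).
have oo : o^T *m B *m o = 2%:R%:M.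
  rewrite [LHS]mx11_scalar; congr _%:M; rewrite -/(bform B o o) bform_octone !mxE.
  by rewrite !eqxx -!val_eqE /= !inordK //= addr0 add0r.
have oQ : o^T *m B *m Q = 0.
  rewrite mulmxBr mulmx1 -scalemxAr [o^T *m B *m _]mulmxA oo mul_scalar_mx scalerA mulrC h2.
  by rewrite scale1r subrr.
have oJ : o^T *m B *m J = 0.
  apply: eq_mulmx_col => y; rewrite mul0mx -mulmxA [LHS]mx11_scalar.
  by rewrite -/(bform B o (J *m y)) octone_imaginary raddf0.
have JQ : J *m (J' *m Q) = Q.
  apply: eq_mulmx_col => x; rewrite -!mulmxA imaginary_projK //.
  by rewrite /bform mulmxA oQ mul0mx mxE.
have QJ : Q *m J = J by rewrite mulmxBl mul1mx -scalemxAl -mulmxA oJ mulmx0 scaler0 subr0.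
have BQ : B *m Q = Q^T *m B.
  rewrite mulmxBr mulmx1 [Q^T]linearB /= trmx1 mulmxBl mul1mx; congr (_ - _).
  rewrite [(_ *: _)^T]linearZ /= -scalemxAl -scalemxAr !trmx_mul trmxK octB_sym.
  by rewrite !mulmxA.
exists (J' *m Q *m B *m J'^T); rewrite /imaginary_gram.
transitivity (J^T *m (B *m (J *m (J' *m Q))) *m B *m J'^T); first by rewrite !mulmxA.
rewrite JQ BQ !mulmxA -trmx_mul QJ -(mulmxA _ B B) octB_inv mulmx1.
by rewrite -trmx_mul imaginary_inclK trmx1.
Qed.
End Imaginary.

Section ImaginaryBaseChange.
Variables (A B : comPzRingType) (f : {rmorphism A -> B}).

Lemma map_imaginary_incl : map_mx f (imaginary_incl A) = imaginary_incl B.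
Proof. by rewrite [LHS](@map_col_mx _ _ f 7 1 7) map_mx1 map_mxN map_delta_mx. Qed.

Lemma map_imaginary_proj : map_mx f (imaginary_proj A) = imaginary_proj B.
Proof. by rewrite [LHS](@map_row_mx _ _ f 7 7 1) map_mx1 map_mx0. Qed.

Lemma map_imaginary_gram : map_mx f (imaginary_gram A) = imaginary_gram B.
Proof. by rewrite !map_mxM map_octB_mx -map_trmx map_imaginary_incl. Qed.
End ImaginaryBaseChange.

Section ImaginaryIso.
Local Open Scope classical_set_scope.
Variable R : realType.
Local Notation C := R[i].

Lemma imaginary_gram_nondegenerate : nondegenerate_form (imaginary_gram C).
Proof.
split; first exact: imaginary_gram_sym.
have [|K /mulmx1_unit[]//] := @imaginary_gram_inv C 2%:R^-1.
by rewrite mulfV ?pnatr_eq0.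
Qed.

Lemma oct_orthogonal_OG : isomorphic (@oct_orthogonal R) (OG 2 (imaginary_gram C)).
Proof.
have Gsym := imaginary_gram_sym C.
apply: (@isomorphic_linear R 8 7 _ _ (imaginary_proj C) (imaginary_incl C)) => A W;
  rewrite map_imaginary_proj map_imaginary_incl.
  move=> [pW Wo]; have JJ' w : W w -> imaginary_incl A *m (imaginary_proj A *m w) = w.
    by move=> /Wo; apply: imaginary_projK.
  split=> //; apply/OG2_isoplane => //; rewrite map_imaginary_gram.
  apply: (isoplane_linear (J' := imaginary_incl A) pW JJ') => x y Wx Wy.
  by rewrite -bform_imaginary !JJ'.
have J'J w : imaginary_proj A *m (imaginary_incl A *m w) = w.
  by rewrite mulmxA imaginary_inclK mul1mx.
move=> hW; have pW : isoplane (imaginary_gram A) W.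
  by rewrite -(map_imaginary_gram (in_alg A)); apply/OG2_isoplane.
split=> //; split.
  by apply: (isoplane_linear (J' := imaginary_proj A) pW) => // x y _ _; rewrite bform_imaginary.
by move=> _ [y _ <-]; apply: octone_imaginary.
Qed.

Lemma spin9_locus_OG : isomorphic
  (@zero_locus R 2 9 16 (spin9_gram R) (spin9 C) (spin9_vector R)) (OG 2 (imaginary_gram C)).
Proof.
apply: isomorphic_trans (spin9_zero_locus R) _.
exact: isomorphic_trans (triality_isomorphic R) oct_orthogonal_OG.
Qed.
End ImaginaryIso.

(** * Uniqueness of the spinor module *)

Section FockIntertwiner.
Variable E : pzRingType.

Definition anticommute (x y : E) := x * y = - (y * x).

(* Fermionic annihilation operators e and creation operators f, of which g is the
   parity up to sign. *)
Record fock_rel (n : nat) (e f : nat -> E) (g : E) : Prop := FockRel {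
  fock_ee : forall i, (i < n)%N -> e i * e i = 0;
  fock_ff : forall i, (i < n)%N -> f i * f i = 0;
  fock_ef : forall i, (i < n)%N -> e i * f i + f i * e i = 1;
  fock_off : forall i j, (i < n)%N -> (j < n)%N -> i != j ->
    [/\ anticommute (e i) (e j), anticommute (e i) (f j),
        anticommute (f i) (e j) & anticommute (f i) (f j)];
  fock_g : forall i, (i < n)%N -> anticommute g (e i) /\ anticommute g (f i) }.

Lemma anticommute2 (y e f : E) : anticommute y e -> anticommute y f ->
  y * (e * f) = e * f * y.
Proof. by move=> ye yf; rewrite mulrA ye mulNr -mulrA yf mulrN opprK mulrA. Qed.

(** Each e_i f_i = 1 - f_i e_i is a projection onto the kernel of e_i, and these commute; the
    product projects onto the common kernel, the vacuum. *)
Fixpoint vacuum_proj (e f : nat -> E) n : E :=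
  if n is m.+1 then e m * f m * vacuum_proj e f m else 1.

Section One.
Variables (n : nat) (e f : nat -> E) (g : E).
Hypothesis h : fock_rel n e f g.

Lemma fock_efe i : (i < n)%N -> e i * f i * e i = e i.
Proof.
move=> hi; have := fock_ef h hi => /(congr1 (fun z => z * e i)).
by rewrite mulrDl -(mulrA (f i)) (fock_ee h hi) mulr0 addr0 mul1r.
Qed.

Lemma fock_fef i : (i < n)%N -> f i * e i * f i = f i.
Proof.
move=> hi; have := fock_ef h hi => /(congr1 (fun z => z * f i)).
by rewrite mulrDl -(mulrA (e i)) (fock_ff h hi) mulr0 add0r mul1r.
Qed.

Lemma vacuum_comm m y : (forall i, (i < m)%N -> y * (e i * f i) = e i * f i * y) ->
  y * vacuum_proj e f m = vacuum_proj e f m * y.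
Proof.
elim: m => [|m IH] hy /=; first by rewrite mulr1 mul1r.
rewrite mulrA hy // -!mulrA IH ?mulrA // => i im; apply: hy; exact: ltnW.
Qed.

Lemma fock_ef_comm i j : (i < n)%N -> (j < n)%N -> i != j ->
  e i * (e j * f j) = e j * f j * e i /\ f i * (e j * f j) = e j * f j * f i.
Proof.
by move=> hi hj ij; have [? ? ? ?] := fock_off h hi hj ij; split; apply: anticommute2.
Qed.

Lemma vacuum_comm_ge m j : (m <= j < n)%N ->
  e j * vacuum_proj e f m = vacuum_proj e f m * e j /\ f j * vacuum_proj e f m = vacuum_proj e f m * f j.
Proof.
case/andP=> mj jn; split; apply: vacuum_comm => i im;
  have ij : (i < j)%N := leq_trans im mj;
  by have [] := fock_ef_comm jn (ltn_trans ij jn) (negbT (gtn_eqF ij)).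
Qed.

Lemma vacuum_comm_ef m : (m < n)%N ->
  e m * f m * vacuum_proj e f m = vacuum_proj e f m * (e m * f m).
Proof.
move=> mn; have [|em fm] := @vacuum_comm_ge m m; first by rewrite leqnn.
by rewrite -mulrA fm !mulrA em.
Qed.

Lemma vacuum_g m : (m <= n)%N -> g * vacuum_proj e f m = vacuum_proj e f m * g.
Proof.
move=> mn; apply: vacuum_comm => i im.
by have [] := fock_g h (leq_trans im mn); apply: anticommute2.
Qed.

Lemma vacuum_absorb m i : (m <= n)%N -> (i < m)%N ->
  e i * f i * vacuum_proj e f m = vacuum_proj e f m.
Proof.
elim: m => // m IH mn; rewrite ltnS leq_eqVlt => /orP[/eqP ->|im] /=.
  by rewrite !mulrA fock_efe.
have [ei fi] := fock_ef_comm (ltn_trans im mn) mn (negbT (ltn_eqF im)).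
by rewrite mulrA -(mulrA (e i)) fi mulrA ei -!mulrA (mulrA (e i)) IH // ltnW.
Qed.

Lemma vacuum_idem m : (m <= n)%N -> vacuum_proj e f m * vacuum_proj e f m = vacuum_proj e f m.
Proof.
elim: m => [|m IH] mn /=; first by rewrite mulr1.
rewrite -mulrA (mulrA (vacuum_proj e f m)) -vacuum_comm_ef // -!mulrA IH ?(ltnW mn) //.
by rewrite !mulrA fock_efe.
Qed.
End One.

Section Two.
Variables (n : nat) (e f : nat -> E) (g : E) (e' f' : nat -> E) (g' : E).
Hypotheses (h : fock_rel n e f g) (h' : fock_rel n e' f' g').

(* If X matches the operators of index > m, adding the two terms below makes it
   match those of index m as well. *)
Definition extend m X := e m * f m * X * (e' m * f' m) + f m * X * e' m.

Lemma extend_new m X : (m < n)%N ->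
  e m * extend m X = extend m X * e' m /\ f m * extend m X = extend m X * f' m.
Proof.
move=> mn; split.
  transitivity (e m * f m * X * e' m).
    by rewrite /extend mulrDr !mulrA (fock_ee h mn) !mul0r add0r.
  rewrite /extend mulrDl -!mulrA (fock_ee h' mn) !mulr0 addr0.
  by rewrite [e' m * _]mulrA (fock_efe h' mn).
transitivity (f m * X * (e' m * f' m)).
  by rewrite /extend mulrDr !mulrA (fock_ff h mn) !mul0r addr0 (fock_fef h mn).
by rewrite /extend mulrDl -!mulrA (fock_ff h' mn) !mulr0 add0r.
Qed.

Lemma extend_old m X y y' : anticommute y (e m) -> anticommute y (f m) ->
  anticommute y' (e' m) -> anticommute y' (f' m) -> y * X = X * y' ->
  y * extend m X = extend m X * y'.
Proof.
move=> ye yf ye' yf' yX; rewrite /extend mulrDr mulrDl; congr (_ + _).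
  rewrite !mulrA -(mulrA y) (anticommute2 ye yf) -!mulrA (mulrA y) yX -!mulrA.
  by rewrite (anticommute2 ye' yf') -!mulrA.
by rewrite !mulrA yf !mulNr -(mulrA (f m)) yX -!mulrA ye' !mulrN opprK.
Qed.

(** Descending recursion: X starts as a map between vacuum spaces (m = n) and is extended over one
    pair of operators at a time. At m = 0 it matches all of them, and the vacuum projection in X' X
    has become 1. *)
Lemma fock_intertwiner m X X' : (m <= n)%N ->
  X' * X = vacuum_proj e' f' m ->
  (forall i, (i < m)%N -> e i * f i * X = X) ->
  (forall i, (m <= i < n)%N -> e i * X = X * e' i /\ f i * X = X * f' i) ->
  g * X = X * g' ->
  exists T T', [/\ T' * T = 1, forall i, (i < n)%N -> e i * T = T * e' i /\ f i * T = T * f' i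
    & g * T = T * g'].
Proof.
elim: m X X' => [|m IH] X X' mn XX absX old gX.
  by exists X, X'; split=> // i; apply: old.
(* The mirror image of [extend]. In its product with the extension of X the cross terms contain e e
   or f f and vanish, and the other two add up by e' f' + f' e' = 1. *)
pose X1' := e' m * f' m * X' * (e m * f m) + f' m * X' * e m.
have absm := absX m (ltnSn m).
apply: (IH (extend m X) X1') => //; first exact: ltnW.
- rewrite /X1' /extend mulrDl !mulrDr.
  have ee := fock_ee h mn; have ff := fock_ff h mn.
  have -> : e' m * f' m * X' * (e m * f m) * (e m * f m * X * (e' m * f' m)) =
      e' m * f' m * vacuum_proj e' f' m.+1 * (e' m * f' m).
    by rewrite -XX absm !mulrA -(mulrA _ (e m) (f m)) -(mulrA _ _ X) absm.
  have -> : e' m * f' m * X' * (e m * f m) * (f m * X * e' m) = 0.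
    by rewrite !mulrA -(mulrA _ (f m) (f m)) ff !(mulr0, mul0r).
  have -> : f' m * X' * e m * (e m * f m * X * (e' m * f' m)) = 0.
    by rewrite !mulrA -(mulrA _ (e m) (e m)) ee !(mulr0, mul0r).
  have -> : f' m * X' * e m * (f m * X * e' m) = f' m * vacuum_proj e' f' m.+1 * e' m.
    by rewrite -XX -{2}absm !mulrA.
  rewrite addr0 add0r /=.
  have -> : e' m * f' m * (e' m * f' m * vacuum_proj e' f' m) * (e' m * f' m) =
     e' m * f' m * vacuum_proj e' f' m.
    rewrite -!mulrA [vacuum_proj _ _ _ * _](esym (vacuum_comm_ef h' mn)) !mulrA.
    by rewrite !(fock_efe h' mn).
  have mm : (m <= m < n)%N by rewrite leqnn.
  have [em fm] := vacuum_comm_ge h' mm.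
  rewrite -(mulrA _ _ (e' m)) -(mulrA _ _ (e' m)) -em !mulrA.
  by rewrite (fock_fef h' mn) -mulrDl (fock_ef h' mn) mul1r.
- move=> i im; have iN := ltn_trans im mn.
  have [em fm] := fock_ef_comm h mn iN (negbT (gtn_eqF im)).
  have absi := absX i (ltnW im); rewrite /extend mulrDr.
  move: (e i * f i) em fm absi => y em fm absi; congr (_ + _).
    by rewrite !mulrA -em -(mulrA (e m)) -fm -!mulrA (mulrA y) absi.
  by rewrite !mulrA -fm -!mulrA (mulrA y) absi.
- move=> i /andP[]; rewrite leq_eqVlt => /orP[/eqP <- _|mi lin]; first exact: extend_new.
  have [X1 X2] := old i (introT andP (conj mi lin)).
  have [? ? ? ?] := fock_off h lin mn (negbT (gtn_eqF mi)).
  have [? ? ? ?] := fock_off h' lin mn (negbT (gtn_eqF mi)).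
  by split; apply: extend_old.
- have [? ?] := fock_g h mn; have [? ?] := fock_g h' mn; exact: extend_old.
Qed.
End Two.
End FockIntertwiner.

Section VacuumVector.
Variables (K : numFieldType) (N : nat).

Lemma idempotent_trace1 (P : 'M[K]_N) : P *m P = P -> \tr P = 1 ->
  exists (x : 'cV_N) (xi : 'rV_N), P = x *m xi /\ xi *m x = 1%:M.
Proof.
move=> PP tP; have rP : \rank P = 1%N.
  by apply/eqP; rewrite -(@eqr_nat K) -mxtrace_idempotent // tP.
have := mulmx_base P; have := row_free_inj (row_base_free P).
have := row_full_inj (col_base_full P).
move: (col_base P) (row_base P); rewrite rP => X Y Xinj Yinj XY.
exists X, Y; split=> //; apply/Yinj/Xinj.
by rewrite /= mul1mx !mulmxA XY -mulmxA XY PP.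
Qed.

(** Each factor halves the trace: e f V and f e V have equal trace by cyclicity, V commuting with e,
    and their sum is V. *)
Lemma vacuum_trace n (e f : nat -> 'M[K]_N) g m : fock_rel n e f g -> (m <= n)%N ->
  2%:R ^+ m * \tr (vacuum_proj e f m) = N%:R.
Proof.
move=> h; elim: m => [|m IH] mn; first by rewrite mul1r mxtrace1.
rewrite -(IH (ltnW mn)) exprSr -mulrA; congr (_ * _).
have mm : (m <= m < n)%N by rewrite leqnn.
have [em _] := vacuum_comm_ge h mm.
have vE : vacuum_proj e f m = e m * f m * vacuum_proj e f m + f m * e m * vacuum_proj e f m.
  by rewrite -mulrDl (fock_ef h mn) mul1r.
rewrite [in RHS]vE mxtraceD mulr_natl mulr2n; congr (_ + _).
change (\tr (e m *m f m *m vacuum_proj e f m) = \tr (f m *m e m *m vacuum_proj e f m)).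
by rewrite -[f m *m _ *m _]mulmxA [e m *m vacuum_proj _ _ _]em mulmxA [RHS]mxtrace_mulC mulmxA.
Qed.

(** As N = 2^n, both vacuum projections have trace 1, hence are x xi and x' xi', and x xi' starts
    the intertwiner. The parity acts on each vacuum by a sign; the product of the two signs is the
    returned s. *)
Lemma fock_rel_unique n (e f : nat -> 'M[K]_N) g (e' f' : nat -> 'M[K]_N) g' :
  N = (2 ^ n)%N -> fock_rel n e f g -> fock_rel n e' f' g' -> g * g = 1 -> g' * g' = 1 ->
  exists (T : 'M[K]_N) (s : K), [/\ T \in unitmx, s = 1 \/ s = -1,
    forall i, (i < n)%N -> e i *m T = T *m e' i /\ f i *m T = T *m f' i
    & g *m T = s *: (T *m g')].
Proof.
move=> Nn h h' gg gg'.
have t1 (e0 f0 : nat -> 'M[K]_N) g0 : fock_rel n e0 f0 g0 -> \tr (vacuum_proj e0 f0 n) = 1.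
  move=> h0; have := vacuum_trace h0 (leqnn n).
  rewrite (_ : N%:R = 2%:R ^+ n); last by rewrite Nn natrX.
  by rewrite -[RHS]mulr1 => /mulfI -> //; rewrite expf_neq0 ?pnatr_eq0.
have [x [xi [Px xix]]] := idempotent_trace1 (vacuum_idem h (leqnn n)) (t1 _ _ _ h).
have [x' [xi' [Px' xix']]] := idempotent_trace1 (vacuum_idem h' (leqnn n)) (t1 _ _ _ h').
have [s gx] : exists s : K, g *m x = s *: x.
  exists ((xi *m g *m x) 0 0); rewrite -mul_mx_scalar -mx11_scalar !mulmxA -Px.
  by rewrite -[_ *m g](vacuum_g h (leqnn n)) Px -mulmxA -mulmxA xix mulmx1.
have [s' xg'] : exists s : K, xi' *m g' = s *: xi'.
  exists ((xi' *m g' *m x') 0 0); rewrite -mul_scalar_mx -mx11_scalar -!mulmxA -Px'.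
  by rewrite -[g' *m _](esym (vacuum_g h' (leqnn n))) Px' !mulmxA xix' mul1mx.
have XX : x' *m xi *m (x *m xi') = vacuum_proj e' f' n.
  by rewrite -mulmxA (mulmxA xi) xix mul1mx Px'.
have absX i : (i < n)%N -> e i *m f i *m (x *m xi') = x *m xi'.
  move=> hi; rewrite mulmxA; congr (_ *m _).
  have := vacuum_absorb h (leqnn n) hi; rewrite Px => /(congr1 (fun Z => Z *m x)).
  change (e i *m f i *m (x *m xi) *m x = x *m xi *m x -> e i *m f i *m x = x).
  by rewrite -!mulmxA xix !mulmx1.
have ss : s * s = 1.
  have : g *m (g *m x) = (s * s) *: x by rewrite gx -scalemxAr gx scalerA.
  rewrite mulmxA [g *m g]gg mul1mx => /(congr1 (fun Z => (xi *m Z) 0 0)).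
  by rewrite -scalemxAr xix !mxE mulr1 => <-.
have ss' : s' * s' = 1.
  have : xi' *m g' *m g' = (s' * s') *: xi' by rewrite xg' -scalemxAl xg' scalerA.
  rewrite -mulmxA [g' *m g']gg' mulmx1 => /(congr1 (fun Z => (Z *m x') 0 0)).
  by rewrite -scalemxAl xix' !mxE mulr1 => <-.
(* Rescaling the second parity by both signs makes the two vacua agree and keeps the anticommutation
   relations. *)
have h'' : fock_rel n e' f' ((s * s') *: g').
  have aZ (y : 'M[K]_N) : anticommute g' y -> anticommute ((s * s') *: g') y.
    change (g' *m y = - (y *m g') ->
      (s * s' *: g') *m y = - (y *m (s * s' *: g'))) => e0.
    by rewrite -scalemxAl e0 -scalemxAr scalerN.
  case: (h') => h1 h2 h3 h4 h5; split=> // i /h5[? ?]; split; exact: aZ.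
have gX : g *m (x *m xi') = x *m xi' *m (s * s' *: g').
  rewrite mulmxA gx -scalemxAl -scalemxAr -mulmxA xg' -scalemxAr scalerA -mulrA.
  by rewrite ss' mulr1.
have [||T [T' [T'T eT gT]]] := @fock_intertwiner _ n e f g e' f' _ h h'' n _ _ (leqnn n) XX absX.
- by move=> i; rewrite leqNgt andNb.
- exact: gX.
exists T, (s * s'); split=> //.
- by have [] := mulmx1_unit T'T.
- have : (s * s' - 1) * (s * s' + 1) = 0.
    by transitivity (s * s * (s' * s') - 1); [ring|rewrite ss ss' mulr1 subrr].
  move=> /eqP; rewrite mulf_eq0 subr_eq0 addr_eq0 => /orP[/eqP ->|/eqP ->]; by [left|right].
- by rewrite scalemxAr.
Qed.
End VacuumVector.

Section SpinorUniqueness.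
Variables (K : numFieldType) (gamma : 'I_(1 + 8) -> 'M[K]_16).
Local Notation B := (octB_mx K).
Hypothesis gammaP : forall v w, cliff gamma v *m cliff gamma w + cliff gamma w *m cliff gamma v
  = (bform (spin9_form K) v w)%:M.

(** The octonions e_0, ..., e_3 span an isotropic space, the columns of B with these indices are
    isotropic and dual to them, and the vector (1, 0) is orthogonal to both. *)
Definition fock_e (rho : 'I_(1 + 8) -> 'M[K]_16) (i : nat) : 'M[K]_16 :=
  cliff rho (col_mx 0 (delta_mx (inord i) 0)).
Definition fock_f (rho : 'I_(1 + 8) -> 'M[K]_16) (i : nat) : 'M[K]_16 :=
  cliff rho (col_mx 0 (col (inord i) B)).
Definition fock_parity (rho : 'I_(1 + 8) -> 'M[K]_16) : 'M[K]_16 := cliff rho (col_mx 1%:M 0).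

Lemma octB_isotropic i j : (i < 4)%N -> (j < 4)%N -> B (inord i) (inord j) = 0.
Proof.
move=> hi hj; rewrite mxE !inordK ?(leq_trans hi) ?(leq_trans hj) //.
have h : all (fun i => all (fun j => octB i j == 0) (iota 0 4)) (iota 0 4) by vm_compute.
have := allP h i; rewrite mem_iota => /(_ hi)/allP/(_ j).
by rewrite mem_iota => /(_ hj)/eqP ->.
Qed.

Lemma gamma_anticomm8 x y : cliff gamma (col_mx 0 x) *m cliff gamma (col_mx 0 y)
  + cliff gamma (col_mx 0 y) *m cliff gamma (col_mx 0 x) = (bform B x y)%:M.
Proof. by rewrite gammaP bform_spin9. Qed.

Lemma anticommute_of_sum0 (X Y : 'M[K]_16) : X *m Y + Y *m X = 0%:M -> anticommute X Y.
Proof. by rewrite raddf0 => /eqP; rewrite addr_eq0 => /eqP. Qed.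

Lemma sqr_of_double (X : 'M[K]_16) a : X *m X + X *m X = (2%:R * a)%:M -> X * X = a%:M.
Proof.
rewrite -mulr2n -scaler_nat => /(congr1 (fun Z => 2%:R^-1 *: Z)).
by rewrite scalerA scale_scalar_mx mulrA mulVf ?pnatr_eq0 // mul1r scale1r.
Qed.

Lemma spinor_fock_rel : fock_rel 4 (fock_e gamma) (fock_f gamma) (fock_parity gamma).
Proof.
have bee i j : (i < 4)%N -> (j < 4)%N ->
    bform B (delta_mx (inord i) 0) (delta_mx (inord j) 0) = 0.
  by move=> hi hj; rewrite bform_delta octB_isotropic.
have bxf x j : bform B x (col (inord j) B) = x (inord j) 0 by rewrite (bform_dual _ _ (octB_inv K)).
have beC x y : bform B x y = bform B y x by apply/bformC/octB_sym.
have bff i j : (i < 4)%N -> (j < 4)%N -> bform B (col (inord i) B) (col (inord j) B) = 0.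
  by move=> hi hj; rewrite bxf mxE octB_isotropic.
have bef i j : (i < 4)%N -> (j < 4)%N ->
    bform B (delta_mx (inord i) 0) (col (inord j) B) = (i == j)%:R.
  move=> hi hj; rewrite bxf mxE andbT -val_eqE /= !inordK 1?eq_sym //.
    exact: leq_trans hi _.
  exact: leq_trans hj _.
split.
- move=> i hi; rewrite -[RHS](raddf0 (@scalar_mx K 16)); apply: sqr_of_double.
  by rewrite gamma_anticomm8 bee // mulr0.
- move=> i hi; rewrite -[RHS](raddf0 (@scalar_mx K 16)); apply: sqr_of_double.
  by rewrite gamma_anticomm8 bff // mulr0.
- by move=> i hi; apply: etrans (gamma_anticomm8 _ _) _; rewrite bef // eqxx.
- move=> i j hi hj ij; split; apply: anticommute_of_sum0; rewrite gamma_anticomm8.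
  + by rewrite bee.
  + by rewrite bef // (negPf ij).
  + by rewrite beC bef // eq_sym (negPf ij).
  + by rewrite bff.
move=> i hi; split; apply: anticommute_of_sum0; rewrite gammaP bform_spin9_col;
  by rewrite [(0 : 'cV_1) 0 0]mxE mulr0 add0r /bform trmx0 !mul0mx mxE.
Qed.

Lemma spinor_parity_sqr : fock_parity gamma * fock_parity gamma = 1.
Proof.
apply: sqr_of_double; rewrite gammaP bform_spin9_col /bform mulmx0 !mxE.
by rewrite !eqxx !mulr1 addr0.
Qed.
End SpinorUniqueness.

(** b pairs e_0 with e_7 by 1 and e_k with e_(k + 3) by -1 for k = 1, 2, 3, so the last four basis
    vectors are multiples of columns of B. *)
Lemma oct_basis_hyperbolic (K : numFieldType) (a : 'I_8) : 
  (exists2 i, (i < 4)%N & delta_mx a 0 = delta_mx (inord i) 0 :> 'cV[K]_8) \/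
  exists i (s : K), (i < 4)%N /\ delta_mx a 0 = s *: col (inord i) (octB_mx K).
Proof.
have [a4|a4] := ltnP a 4.
  by left; exists a => //; congr delta_mx; apply/val_inj; rewrite /= inordK.
right; pose i := if a == 7 :> nat then 0%N else (a - 3)%N.
pose s : int := if a == 7 :> nat then 1 else -1.
have i4 : (i < 4)%N by rewrite /i; case: (a) a4 => -[|[|[|[|[|[|[|[]]]]]]]].
exists i, s%:~R; split=> //; apply/colP => j; rewrite !mxE andbT inordK ?(leq_trans i4) //.
have h : all8 (fun a => all8 (fun j => (4 <= a)%N ==> ((j == a)%:Z ==
   (if a == 7 then 1 else -1) * octB j (if a == 7 then 0 else a - 3)%N))) by vm_compute.
have /implyP/(_ a4)/eqP e := all8_2P h a j.
by rewrite -intrM /s /i -e -val_eqE.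
Qed.

(** The sign distinguishes the two simple modules of the Clifford algebra in odd dimension. It is
    carried by (c, v) |-> (s c, v), an isometry of V. *)
Lemma spinor_unique (K : numFieldType) (gamma rho : 'I_(1 + 8) -> 'M[K]_16) :
  (forall v w, cliff gamma v *m cliff gamma w + cliff gamma w *m cliff gamma v
     = (bform (spin9_form K) v w)%:M) ->
  (forall v w, cliff rho v *m cliff rho w + cliff rho w *m cliff rho v
     = (bform (spin9_form K) v w)%:M) ->
  exists (T : 'M[K]_16) (s : K), [/\ T \in unitmx, s = 1 \/ s = -1 &
    forall c v, cliff gamma (col_mx c v) *m T = T *m cliff rho (col_mx (s *: c) v)].
Proof.
move=> gP sP.
have [T [s [Tu hs eT gT]]] := @fock_rel_unique K 16 4 _ _ _ _ _ _ erefl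
  (spinor_fock_rel gP) (spinor_fock_rel sP) (spinor_parity_sqr gP) (spinor_parity_sqr sP).
exists T, s; split=> // c v.
have vT (x : 'cV_8) : cliff gamma (col_mx 0 x) *m T = T *m cliff rho (col_mx 0 x).
  pose P : 'M[K]_(1 + 8, 8) := col_mx 0 1%:M.
  have PE (y : 'cV_8) : col_mx 0 y = P *m y by rewrite mul_col_mx mul0mx mul1mx.
  rewrite PE !cliff_mulmx mulmx_suml mulmx_sumr; apply: eq_bigr => a _.
  rewrite -scalemxAl -scalemxAr; congr (_ *: _).
  rewrite colE -PE; have [[i i4 ->]|[i [t [i4 ->]]]] := oct_basis_hyperbolic K a.
    by have [] := eT i i4.
  have -> : col_mx 0 (t *: col (inord i) (octB_mx K)) =
      t *: col_mx (0 : 'cV_1) (col (inord i) (octB_mx K)) by rewrite scale_col_mx scaler0.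
  rewrite [cliff gamma _]linearZ [cliff rho _]linearZ /= -scalemxAl -scalemxAr.
  by congr (_ *: _); have [] := eT i i4.
have cvE (d : 'cV[K]_1) : col_mx d v = d 0 0 *: col_mx 1%:M 0 + col_mx 0 v.
  by rewrite scale_col_mx add_col_mx scaler0 add0r addr0 scale_scalar_mx mulr1 -mx11_scalar.
rewrite cvE [col_mx (s *: c) v]cvE [cliff gamma _]linearD [cliff rho _]linearD /=.
rewrite [cliff gamma (_ *: _)]linearZ [cliff rho (_ *: _)]linearZ /= mulmxDl mulmxDr vT.
by rewrite -scalemxAl -scalemxAr [_ *m T]gT scalerA !mxE [s * _]mulrC.
Qed.

(** * Congruence of symmetric forms *)

Section SymmetricForms.
Variable C : numClosedFieldType.

Lemma nonisotropic_vector n (G : 'M[C]_n.+1) : G^T = G -> G \in unitmx ->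
  exists v, bform G v v != 0.
Proof.
move=> Gsym Gu; apply: contrapT => h.
have q0 v : bform G v v = 0 by apply/eqP/negPn/negP => hv; apply: h; exists v.
suff G0 : G = 0 by move: Gu; rewrite G0 unitmxE det0 unitr0.
apply/matrixP => i j; rewrite -bform_delta mxE.
move: (delta_mx i 0) (delta_mx j 0) => v w.
have := q0 (v + w); rewrite bformDl !bformDr !q0 addr0 add0r (bformC w v) // -mulr2n.
by move/eqP; rewrite mulrn_eq0 => /eqP.
Qed.

(** The matrix [col_ebase] completes v to a basis, and the 1 x 1 matrix [row_ebase] accounts for the
    factor r. *)
Lemma first_column n (v : 'cV[C]_n.+1) : v != 0 ->
  exists (S : 'M[C]_n.+1) (r : C), [/\ S \in unitmx, r != 0 & S *m delta_mx 0 0 = r *: v].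
Proof.
move=> v0; have rv : \rank v = 1%N.
  by apply/eqP; rewrite eqn_leq rank_leq_col lt0n mxrank_eq0.
have := mulmx_ebase v; rewrite rv; have := row_ebase_unit v.
move: (row_ebase v) => r ru e.
exists (col_ebase v), ((invmx r) 0 0); split; first exact: col_ebase_unit.
  have : invmx r \in unitmx by rewrite unitmx_inv.
  by rewrite unitmxE det_mx11 unitfE.
rewrite -mul_mx_scalar -mx11_scalar -{2}e mulmxK //; congr (_ *m _).
by apply/matrixP => -[[|i] hi] j; rewrite !mxE ord1.
Qed.

Lemma symmetric_form_normal n (G : 'M[C]_n) : G^T = G -> G \in unitmx ->
  exists S : 'M[C]_n, S^T *m G *m S = 1%:M.
Proof.
elim: n G => [|n IH] G Gsym Gu; first by exists 0; apply/matrixP => -[].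
have [v vv] := nonisotropic_vector Gsym Gu.
have v0 : v != 0 by apply: contraNneq vv => ->; rewrite /bform mulmx0 mxE.
have [S1 [r [S1u r0 S1v]]] := first_column v0.
pose G1 : 'M[C]_(1 + n) := S1^T *m G *m S1.
have G1sym : G1^T = G1 by rewrite !trmx_mul trmxK Gsym mulmxA.
have G1u : G1 \in unitmx by rewrite !unitmx_mul unitmx_tr S1u Gu.
have G1a : G1 0 0 != 0.
  rewrite -bform_delta /G1.
  have -> : bform (S1^T *m G *m S1) (delta_mx 0 0) (delta_mx 0 0) = bform G (r *: v) (r *: v).
    by rewrite -S1v /bform trmx_mul !mulmxA.
  by rewrite bformZl bformZr !mulf_neq0.
have [a [b [D [a0 G1E]]]] : exists a (b : 'cV[C]_n) (D : 'M[C]_n), a != 0 /\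
    G1 = block_mx a%:M b^T b D.
  exists (G1 0 0), (dlsubmx G1), (drsubmx G1); split=> //.
  rewrite -{1}[G1]submxK -{2}G1sym trmx_dlsub G1sym; congr block_mx.
  have l0 : lshift n (0 : 'I_1) = 0 :> 'I_(1 + n) by apply/val_inj.
  by rewrite [LHS]mx11_scalar !mxE l0.
have bD : D^T = D.
  by move: G1sym; rewrite G1E tr_block_mx => /eq_block_mx[].
(* Completing the square: [S2] clears the first row and column off the diagonal and leaves the Schur
   complement [D']. *)
pose S2 : 'M[C]_(1 + n) := block_mx 1%:M (- (a^-1 *: b^T)) 0 1%:M.
pose D' := D - a^-1 *: (b *m b^T).
have G2E : S2^T *m G1 *m S2 = block_mx a%:M 0 0 D'.
  rewrite /S2 G1E tr_block_mx !mulmx_block !trmx1 !trmx0.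
  rewrite !(mul1mx, mulmx1, mul0mx, mulmx0, addr0, add0r).
  rewrite [(- _)^T]linearN /= [(_ *: _)^T]linearZ /= trmxK.
  congr block_mx.
  - by rewrite mulmxN mul_scalar_mx scalerA mulfV // scale1r addNr.
  - by rewrite mulNmx mul_mx_scalar scalerA mulfV // scale1r addNr.
  - by rewrite !mulNmx mul_mx_scalar scalerA mulfV // scale1r addNr mul0mx add0r -scalemxAl addrC.
have S2u : S2 \in unitmx by rewrite unitmxE det_ublock !det1 mulr1 unitr1.
have D'u : D' \in unitmx.
  have : S2^T *m G1 *m S2 \in unitmx by rewrite 2!unitmx_mul unitmx_tr S2u G1u.
  by rewrite G2E unitmxE det_ublock unitrM -unitmxE => /andP[].
have D'sym : D'^T = D'.
  by rewrite [D'^T]linearB /= [(_ *: _)^T]linearZ /= trmx_mul trmxK bD.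
have [S' S'P] := IH D' D'sym D'u.
(* The square root, available over a closed field, normalises the first diagonal entry to 1. *)
pose s := sqrtC a^-1.
pose S3 : 'M[C]_(1 + n) := block_mx s%:M 0 0 S'.
exists (S1 *m S2 *m S3).
have -> : (S1 *m S2 *m S3)^T *m G *m (S1 *m S2 *m S3) = S3^T *m (S2^T *m G1 *m S2) *m S3.
  by rewrite !trmx_mul !mulmxA.
rewrite G2E /S3 tr_block_mx !mulmx_block !trmx0 tr_scalar_mx.
rewrite !(mul1mx, mulmx1, mul0mx, mulmx0, addr0, add0r) S'P -!scalar_mxM.
rewrite mulrC mulrA -expr2 sqrtCK mulVf // -scalar_mx_block //.
Qed.

Lemma symmetric_forms_congruent n (G G' : 'M[C]_n) :
  G^T = G -> G \in unitmx -> G'^T = G' -> G' \in unitmx ->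
  exists S : 'M[C]_n, S \in unitmx /\ S^T *m G *m S = G'.
Proof.
move=> Gs Gu Gs' Gu'.
have [S SP] := symmetric_form_normal Gs Gu; have [S' SP'] := symmetric_form_normal Gs' Gu'.
have [_ Su'] := mulmx1_unit SP'; have [_ Su] := mulmx1_unit SP.
exists (S *m invmx S'); split; first by rewrite unitmx_mul Su unitmx_inv.
have -> : (S *m invmx S')^T *m G *m (S *m invmx S') =
    (invmx S')^T *m (S^T *m G *m S) *m invmx S' by rewrite trmx_mul !mulmxA.
by rewrite SP -SP' trmx_inv !mulmxA mulVmx ?unitmx_tr // mul1mx mulmxK.
Qed.
End SymmetricForms.

(** * Transport of zero loci along isometries *)

Section Transport.
Local Open Scope classical_set_scope.
Variable R : realType.
Local Notation C := R[i].

Lemma map_mx_invK (A : comAlgType C) n (S : 'M[C]_n) (v : 'cV[A]_n) : S \in unitmx ->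
  (invmx S) ^@ A *m (S ^@ A *m v) = v.
Proof. by move=> Su; rewrite mulmxA -map_mxM mulVmx // map_mx1 mul1mx. Qed.

Lemma isoplane_isometry (A : comAlgType C) n (G G' S : 'M[C]_n) (W : set 'cV[A]_n) :
  S \in unitmx -> S^T *m G' *m S = G -> isoplane (G ^@ A) W ->
  isoplane (G' ^@ A) (mulmx (S ^@ A) @` W).
Proof.
move=> Su SG pW.
apply: (isoplane_linear (J' := (invmx S) ^@ A) pW) => [w _|x y _ _ <-].
  exact: map_mx_invK.
by rewrite -SG /bform !map_mxM trmx_mul -map_trmx !mulmxA.
Qed.

Lemma isometry_inv n (G G' S : 'M[C]_n) : S \in unitmx -> S^T *m G' *m S = G ->
  (invmx S)^T *m G *m invmx S = G'.
Proof.
by move=> Su <-; rewrite trmx_inv !mulmxA mulVmx ?unitmx_tr // mul1mx mulmxK.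
Qed.

Lemma OG2_isometry n (G G' S : 'M[C]_n) : G^T = G -> G'^T = G' ->
  S \in unitmx -> S^T *m G' *m S = G -> isomorphic (OG 2 G) (OG 2 G').
Proof.
move=> Gs Gs' Su SG; apply: (@isomorphic_linear R n n _ _ S (invmx S)) => A W.
  move=> /(OG2_isoplane W Gs) hW; split; last by move=> w _; apply: map_mx_invK.
  by apply/OG2_isoplane => //; apply: isoplane_isometry SG hW.
move=> /(OG2_isoplane W Gs') hW; split.
  apply/OG2_isoplane => //; apply: isoplane_isometry (isometry_inv Su SG) hW.
  by rewrite unitmx_inv.
by move=> w _; rewrite mulmxA -map_mxM mulmxV // map_mx1 mul1mx.
Qed.

Section Spinors.
Variables (m N : nat).

Record spin_isometry (G : 'M[C]_m) (gamma : 'I_m -> 'M[C]_N) (G' : 'M[C]_m)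
    (gamma' : 'I_m -> 'M[C]_N) (S : 'M[C]_m) (T : 'M[C]_N) : Prop := SpinIsometry {
  spin_isometry_unit : S \in unitmx;
  spin_isometry_unitT : T \in unitmx;
  spin_isometry_form : S^T *m G' *m S = G;
  spin_isometry_act : forall v, T *m cliff gamma v = cliff gamma' (S *m v) *m T }.

Lemma spin_isometry_inv G gamma G' gamma' S T : spin_isometry G gamma G' gamma' S T ->
  spin_isometry G' gamma' G gamma (invmx S) (invmx T).
Proof.
case=> Su Tu SG act; split; rewrite ?unitmx_inv //; first exact: isometry_inv.
move=> v; have := act (invmx S *m v); rewrite mulmxA mulmxV // mul1mx.
move=> /(congr1 (fun Z => invmx T *m Z *m invmx T)).
by rewrite mulKmx // !mulmxA mulmxK.
Qed.

Variables (G G' : 'M[C]_m) (gamma gamma' : 'I_m -> 'M[C]_N).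
Hypotheses (hG : nondegenerate_form G) (hgamma : clifford_action G gamma).
Hypotheses (hG' : nondegenerate_form G') (hgamma' : clifford_action G' gamma').

Lemma zero_locus_image (A : comAlgType C) S T delta (W : set 'cV[A]_m) :
  spin_isometry G gamma G' gamma' S T -> zero_locus 2 G gamma delta W ->
  zero_locus 2 G' gamma' (T *m delta) (mulmx (S ^@ A) @` W).
Proof.
case=> Su Tu SG act /(zero_locusE _ W hG hgamma)[pW kill].
apply/(zero_locusE _ _ hG' hgamma'); split.
  apply: isoplane_isometry Su _ pW.
  by rewrite -scalemxAr -scalemxAl SG.
have actA (v : 'cV[A]_m) : T ^@ A *m cliff (fun i => (gamma i) ^@ A) v =
    cliff (fun i => (gamma' i) ^@ A) (S ^@ A *m v) *m T ^@ A.
  (* Both sides are linear in v, and the columns of the identity matrix come from C, where [act]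
     applies. *)
  rewrite -{1}[v]mul1mx -(map_mx1 (in_alg A)) !cliff_mulmx mulmx_sumr mulmx_suml.
  apply: eq_bigr => a _; rewrite -scalemxAr -scalemxAl; congr (_ *: _).
  rewrite -!map_col -!map_cliff -!map_mxM act; congr (map_mx _ (cliff _ _ *m _)).
  by rewrite !colE mul1mx.
move=> _ _ [u Wu <-] [v Wv <-].
by rewrite map_mxM (mulmxA (cliff _ (_ *m v))) -actA -mulmxA mulmxA -actA -mulmxA kill // mulmx0.
Qed.

End Spinors.

Lemma zero_locus_spin_isometry m N (G G' : 'M[C]_m) (gamma gamma' : 'I_m -> 'M[C]_N) S T delta :
  nondegenerate_form G -> clifford_action G gamma ->
  nondegenerate_form G' -> clifford_action G' gamma' ->
  spin_isometry G gamma G' gamma' S T ->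
  isomorphic (zero_locus 2 G gamma delta) (zero_locus 2 G' gamma' (T *m delta)).
Proof.
move=> hG hg hG' hg' iso; have [Su Tu _ _] := iso.
apply: (@isomorphic_linear R m m _ _ S (invmx S)) => A W hW; split.
- exact: zero_locus_image hW.
- by move=> w _; apply: map_mx_invK.
- rewrite -[delta](mulKmx Tu).
  exact: (zero_locus_image hG' hg' hG hg (spin_isometry_inv iso) hW).
- by move=> w _; rewrite mulmxA -map_mxM mulmxV // map_mx1 mul1mx.
Qed.
End Transport.

(** * The orbit of a general spinor *)

Section Reflections.
Variables (K : numFieldType) (n : nat) (B : 'M[K]_n).

Lemma bform_inj (X Y : 'M[K]_n) : (forall u v, bform X u v = bform Y u v) -> X = Y.
Proof. by move=> h; apply/matrixP => i j; rewrite -!bform_delta h. Qed.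

(* The negative of the orthogonal reflection in w. *)
Definition reflection (w : 'cV[K]_n) : 'M[K]_n :=
  (2%:R^-1 * bform B w w)^-1 *: (w *m (w^T *m B)) - 1%:M.

Lemma reflectionE w v :
  reflection w *m v = ((2%:R^-1 * bform B w w)^-1 * bform B w v) *: w + (-1) *: v.
Proof.
rewrite mulmxBl mul1mx scaleN1r -scalemxAl -mulmxA -scalerA; congr (_ *: _ - _).
by rewrite [w^T *m B *m v]mx11_scalar mul_mx_scalar.
Qed.

Lemma reflection_form w : B^T = B -> bform B w w != 0 ->
  (reflection w)^T *m B *m reflection w = B.
Proof.
move=> Bsym ww; apply: bform_inj => u v.
transitivity (bform B (reflection w *m u) (reflection w *m v)).
  by rewrite /bform trmx_mul !mulmxA.
rewrite !reflectionE !(bformDl, bformDr, bformZl, bformZr) (bformC u w Bsym).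
by field; rewrite ww.
Qed.
End Reflections.

Section SpinorOrbit.
Variable R : realType.
Local Notation C := R[i].
Local Notation F := (spin9_form C).
Local Notation G0 := (spin9_gram R : 'M[C]_(1 + 8)).
Local Notation rho := (spin9 C : 'I_(1 + 8) -> 'M[C]_16).
Local Notation b := (bform (octB_mx C)).
Local Notation locus d := (@zero_locus R 2 (1 + 8) 16 G0 rho d).

Lemma rho_anticomm v w :
  cliff rho v *m cliff rho w + cliff rho w *m cliff rho v = (bform F v w)%:M.
Proof. exact: spin9_anticomm. Qed.

(** With q = F(w, w) / 2, the Clifford relation gives w v w^-1 = (F(w, v) / q) w - v. This is minus
    the reflection of v, so with this sign the action of w is an intertwiner. *)
Lemma reflection_isometry w : bform F w w != 0 ->
  spin_isometry G0 rho G0 rho (reflection F w) (cliff rho w).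
Proof.
move=> ww; set q := 2%:R^-1 * bform F w w.
have q0 : q != 0 by rewrite mulf_neq0 ?invr_eq0 ?pnatr_eq0.
have Fww : bform F w w = 2%:R * q by rewrite mulrA mulfV ?mul1r ?pnatr_eq0.
have [G0sym G0u] := spin9_gram_nondegenerate R.
have wwq : cliff rho w *m cliff rho w = q%:M.
  by apply: sqr_of_double; rewrite rho_anticomm Fww.
have SF : (reflection F w)^T *m G0 *m reflection F w = G0.
  rewrite -scalemxAr -scalemxAl; congr (_ *: _).
  exact: reflection_form (spin9_form_sym C) ww.
split=> //.
- have : (reflection F w)^T *m G0 *m reflection F w \in unitmx by rewrite SF.
  by rewrite unitmx_mul => /andP[].
- have /mulmx1_unit[//] : cliff rho w *m (q^-1 *: cliff rho w) = 1%:M.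
  by rewrite -scalemxAr wwq scale_scalar_mx mulVf.
move=> v; rewrite reflectionE -/q scaleN1r linearB linearZ /= mulmxBl -scalemxAl wwq.
rewrite scale_scalar_mx mulrAC mulVf // mul1r -(rho_anticomm w v).
by rewrite addrK.
Qed.

Lemma scalar_isometry (c : C) : c != 0 ->
  spin_isometry G0 rho G0 rho 1%:M (c%:M).
Proof.
move=> c0; split; rewrite ?unitmx1 //.
- by rewrite unitmxE det_scalar unitrX // unitfE.
- by rewrite trmx1 mul1mx mulmx1.
by move=> v; rewrite mul1mx mul_scalar_mx mul_mx_scalar.
Qed.

Lemma locus_isometry S T d d' : spin_isometry G0 rho G0 rho S T -> T *m d = d' ->
  isomorphic (locus d) (locus d').
Proof.
move=> iso <-; apply: zero_locus_spin_isometry iso;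
  by [exact: spin9_gram_nondegenerate|exact: spin9_action].
Qed.

(* The reflections in (n x, y \bar x), (0, \bar x') and (0, 1) successively move
   (x, y) to (x', 0), (0, n x' . 1) and (n x' . 1, 0), where n v = b v v / 2. *)
Lemma locus_standard (x y : 'cV[C]_8) : b x x != 0 -> b x x + b y y != 0 ->
  isomorphic (locus (col_mx x y : 'cV_(8 + 8))) (locus (spin9_vector R)).
Proof.
move=> xx xxyy.
have LR := @octLR C; have one2 : b (octone C) (octone C) = 2%:R.
  by rewrite bform_octone !mxE !eqxx -!val_eqE /= !inordK //= addr0 add0r.
have half2 (a : C) : a = 2%:R * (2%:R^-1 * a) by rewrite mulrA mulfV ?mul1r ?pnatr_eq0.
have RR' z t : cliff (oct_mx C octR) z *m (cliff (oct_mx C octR') z *m t) =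
    (2%:R^-1 * b z z) *: t.
  rewrite mulmxA; have := octRR' z z; rewrite -mulr2n -scaler_nat.
  move=> /(congr1 (fun Z => 2%:R^-1 *: Z)); rewrite scalerA mulVf ?pnatr_eq0 // scale1r => ->.
  by rewrite scale_scalar_mx mul_scalar_mx.
have LL' z t : cliff (oct_mx C octL) z *m (cliff (oct_mx C octL') z *m t) =
    (2%:R^-1 * b z z) *: t.
  rewrite mulmxA; have := octLL' z z; rewrite -mulr2n -scaler_nat.
  move=> /(congr1 (fun Z => 2%:R^-1 *: Z)); rewrite scalerA mulVf ?pnatr_eq0 // scale1r => ->.
  by rewrite scale_scalar_mx mul_scalar_mx.
have bR'R' z t : b (cliff (oct_mx C octR') z *m t) (cliff (oct_mx C octR') z *m t) =
    2%:R^-1 * b z z * b t t by rewrite octR_adjoint RR' bformZl.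
have L'1 : cliff (oct_mx C octL') (octone C) *m octone C = octone C.
  have := octL'L (octone C) (octone C); rewrite one2 -mulr2n -scaler_nat.
  move=> /(congr1 (fun Z => 2%:R^-1 *: Z *m octone C)).
  by rewrite !scalerA scale_scalar_mx mulVf ?pnatr_eq0 // scale1r mul1mx -mulmxA octL_one.
(* v = y \bar x is chosen so that the second component v x - nx y vanishes, by (y \bar x) x = nx
   y. *)
pose nx := 2%:R^-1 * b x x; pose v := cliff (oct_mx C octR') x *m y.
have nx0 : nx != 0 by rewrite mulf_neq0 ?invr_eq0 ?pnatr_eq0.
pose x' := nx *: x + cliff (oct_mx C octL') v *m y.
(* In terms of the norm n this is n(x') = n(x) (n(x) + n(y))^2, so both hypotheses together keep x'
   nonisotropic. *)
have x'x' : b x' x' = 2%:R^-1 * nx * (b x x + b y y) ^+ 2.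
  have xz : b x (cliff (oct_mx C octL') v *m y) = nx * b y y.
    by rewrite octL_adjoint LR RR' bformZl.
  have zz : b (cliff (oct_mx C octL') v *m y) (cliff (oct_mx C octL') v *m y) =
      2%:R^-1 * (nx * b y y) * b y y by rewrite octL_adjoint LL' bformZl bR'R'.
  rewrite /x'; move: (cliff (oct_mx C octL') v *m y) xz zz => z xz zz.
  rewrite bformDl !bformDr !(bformZl, bformZr) (bformC z x (octB_sym C)) xz zz.
  by rewrite (half2 (b x x)) -/nx; field.
have x'0 : b x' x' != 0 by rewrite x'x' !mulf_neq0 ?invr_eq0 ?pnatr_eq0 ?expf_neq0.
pose nx' := 2%:R^-1 * b x' x'.
have nx'0 : nx' != 0 by rewrite mulf_neq0 ?invr_eq0 ?pnatr_eq0.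
apply: (isomorphic_trans (Y := locus (col_mx x' 0 : 'cV_(8 + 8)))).
  apply: (locus_isometry (@reflection_isometry (col_mx nx%:M v) _)).
    rewrite bform_spin9_col bR'R' -/nx !mxE eqxx mulr1n.
    have -> : 2%:R * nx * nx + nx * b y y = nx * (b x x + b y y).
      by rewrite (half2 (b x x)) -/nx; ring.
    by rewrite mulf_neq0.
  rewrite (cliff_spin9 nx%:M v : cliff rho _ = _) [LHS](@mul_block_col _ 8 8 8 8 1).
  by rewrite !mulNmx !mul_scalar_mx LR RR' -/nx !mxE eqxx mulr1n subrr.
pose v' := cliff (oct_mx C octR') x' *m octone C.
apply: (isomorphic_trans (Y := locus (col_mx 0 (nx' *: octone C) : 'cV_(8 + 8)))).
  apply: (locus_isometry (@reflection_isometry (col_mx 0 v') _)).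
    by rewrite bform_spin9 bR'R' one2 -/nx' mulf_neq0 ?pnatr_eq0.
  rewrite (cliff_spin9 0 v' : cliff rho _ = _) [LHS](@mul_block_col _ 8 8 8 8 1).
  by rewrite !mulmx0 !addr0 mul_scalar_mx mxE scale0r LR RR'.
apply: (isomorphic_trans (Y := locus (col_mx (nx' *: octone C) 0 : 'cV_(8 + 8)))).
  apply: (locus_isometry (@reflection_isometry (col_mx 0 (octone C)) _)).
    by rewrite bform_spin9 one2 pnatr_eq0.
  rewrite (cliff_spin9 0 (octone C) : cliff rho _ = _) [LHS](@mul_block_col _ 8 8 8 8 1).
  rewrite !mulmx0 !add0r !mulNmx !mul_scalar_mx [(0 : 'cV_1) 0 0]mxE scale0r oppr0.
  by rewrite -scalemxAr L'1.
apply: (locus_isometry (@scalar_isometry nx'^-1 _)); first by rewrite invr_eq0.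
rewrite mul_scalar_mx [LHS](@scale_col_mx _ 8 8 1) scalerA mulVf //.
by rewrite scale1r scaler0 /spin9_vector.
Qed.


(** A congruence S0 takes G to the model form; after this change of basis both actions have the same
    relations and uniqueness of the module supplies T. *)
Lemma locus_of_action (G : 'M[C]_(1 + 8)) (gamma : 'I_(1 + 8) -> 'M[C]_16) :
  nondegenerate_form G -> clifford_action G gamma ->
  exists S T, spin_isometry G gamma G0 rho S T.
Proof.
move=> [Gs Gu] hgamma; have [G0s G0u] := spin9_gram_nondegenerate R.
have [S0 [S0u S0G]] := symmetric_forms_congruent Gs Gu G0s G0u.
pose gamma1 i := cliff gamma (col i S0).
have gamma1E v : cliff gamma1 v = cliff gamma (S0 *m v).
  rewrite -{1}[v]mul1mx !cliff_mulmx; apply: eq_bigr => a _.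
  by rewrite [col a 1%:M]colE mul1mx cliff_delta.
have gP v w : cliff gamma1 v *m cliff gamma1 w + cliff gamma1 w *m cliff gamma1 v =
    (bform F v w)%:M.
  rewrite !gamma1E (@cliff_anticomm _ _ (2%:R *: G)) => [|i j]; last by rewrite hgamma !mxE.
  have -> : F = 2%:R *: G0 by rewrite scalerA mulfV ?pnatr_eq0 // scale1r.
  by rewrite -S0G /bform trmx_mul -!(scalemxAr, scalemxAl) !mulmxA.
have [T [s [Tu hs act]]] := spinor_unique gP rho_anticomm.
have ss : s * s = 1 by case: hs => ->; rewrite ?mulrNN mulr1.
(* D multiplies the C-coordinate by the sign s and preserves the form, so the sign can be moved into
   the isometry. *)
pose D : 'M[C]_(1 + 8) := block_mx s%:M 0 0 1%:M.
have DD : D *m D = 1%:M.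
  rewrite mulmx_block !mulmx0 !mul0mx !mulmx1 !addr0 add0r -scalar_mxM ss.
  by rewrite -scalar_mx_block.
have DE c x : D *m col_mx c x = col_mx (s *: c) x.
  by rewrite mul_block_col !mul0mx mul1mx addr0 add0r mul_scalar_mx.
have Du : D \in unitmx by have [] := mulmx1_unit DD.
have DF : D^T *m F *m D = F.
  rewrite /D tr_block_mx !trmx0 !tr_scalar_mx !mulmx_block.
  rewrite !(mul0mx, mulmx0, mul1mx, mulmx1, addr0, add0r) -!scalar_mxM.
  by rewrite mulrAC ss mul1r.
have [Su Tu' iso act'] : spin_isometry G0 rho G gamma (S0 *m D) T.
  split=> //; first by rewrite unitmx_mul S0u.
    have -> : (S0 *m D)^T *m G *m (S0 *m D) = D^T *m (S0^T *m G *m S0) *m D.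
      by rewrite trmx_mul !mulmxA.
    by rewrite S0G -scalemxAr -scalemxAl DF.
  move=> v; rewrite -mulmxA -gamma1E -{1}[v]mul1mx -DD -[v]vsubmxK -!mulmxA !DE act.
  by rewrite scalerA ss scale1r.
exists (invmx (S0 *m D)), (invmx T); exact: spin_isometry_inv.
Qed.

Lemma map_bform (A B : comPzRingType) (f : {rmorphism A -> B}) n (X : 'M[A]_n) u v :
  f (bform X u v) = bform (map_mx f X) (map_mx f u) (map_mx f v).
Proof. by rewrite /bform map_trmx -!map_mxM [RHS]mxE. Qed.

(** The polynomial is obtained by evaluating the forms on T times the vector of the variables, over
    the polynomial ring; specialisation is then a base change. *)
Lemma for_general_nonisotropic (T : 'M[C]_16) : T \in unitmx ->
  for_general (fun delta : 'cV[C]_16 => exists x y,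
    [/\ T *m delta = col_mx x y :> 'cV_(8 + 8), b x x != 0 & b x x + b y y != 0]).
Proof.
move=> Tu.
pose d : 'cV[{mpoly C[16]}]_(8 + 8) := map_mx (@mpolyC 16 C) T *m \col_j 'X_j.
pose B := octB_mx {mpoly C[16]}.
pose X := usubmx d; pose Y := dsubmx d.
pose p := bform B X X * (bform B X X + bform B Y Y).
have pE (v : 'cV[C]_16) (x := @usubmx _ 8 8 1 (T *m v)) (y := @dsubmx _ 8 8 1 (T *m v)) :
    p.@[fun i => v i 0] = b x x * (b x x + b y y).
  have dE : map_mx (meval (fun i => v i 0)) d = T *m v.
    rewrite map_mxM; congr (_ *m _); apply/matrixP => i j; rewrite !mxE; first exact: mevalC.
    by rewrite ord1; apply: mevalXU.
  have bE Z : meval (fun i => v i 0) (bform B Z Z) =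
      b (map_mx (meval (fun i => v i 0)) Z) (map_mx (meval (fun i => v i 0)) Z).
    by apply: etrans (map_bform (meval _) _ _ _) _; rewrite map_octB_mx.
  have Xx : map_mx (meval (fun i => v i 0)) X = x by apply: etrans (map_usubmx _ _) _; rewrite dE.
  have Yy : map_mx (meval (fun i => v i 0)) Y = y by apply: etrans (map_dsubmx _ _) _; rewrite dE.
  have pM (a c : {mpoly C[16]}) : meval (fun i => v i 0) (a * (a + c)) =
      meval (fun i => v i 0) a * (meval (fun i => v i 0) a + meval (fun i => v i 0) c).
    by rewrite mevalM mevalD.
  have bX := bE X; rewrite Xx in bX.
  have bY := bE Y; rewrite Yy in bY.
  exact: etrans (pM (bform B X X) (bform B Y Y)) (congr2 (fun s t => s * (s + t)) bX bY).
exists p; split=> [|v]; last first.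
  rewrite pE mulf_eq0 negb_or => /andP[hx hxy].
  by exists (@usubmx _ 8 8 1 (T *m v)), (@dsubmx _ 8 8 1 (T *m v)); split=> //; rewrite vsubmxK.
(* At the preimage of (1, 0) under T the value is b(1, 1)^2 = 4. *)
apply/eqP => p0; have := pE (invmx T *m (col_mx (octone C) 0 : 'cV_(8 + 8))).
rewrite p0 meval0 mulKVmx // col_mxKu col_mxKd /=.
rewrite [b 0 0]/bform mulmx0 mxE addr0 bform_octone !mxE !eqxx -!val_eqE /= !inordK //=.
by rewrite addr0 add0r => /esym/eqP; rewrite -natrD -natrM pnatr_eq0.
Qed.
End SpinorOrbit.

Theorem proposition6 (R : realType)
    (G9 : 'M[R[i]]_9) (hG9 : nondegenerate_form G9)
    (G7 : 'M[R[i]]_7) (hG7 : nondegenerate_form G7)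
    (gamma : 'I_9 -> 'M[R[i]]_16) (hgamma : clifford_action G9 gamma) :
  for_general (fun delta : 'cV[R[i]]_16 =>
    isomorphic (zero_locus 2 G9 gamma delta) (OG 2 G7)).
Proof.
have [S [T iso]] := locus_of_action hG9 hgamma.
have [_ Tu _ _] := iso.
have [p [p0 hp]] := for_general_nonisotropic Tu.
exists p; split=> // delta /hp[x [y [Txy xx xxyy]]].
have [G7s G7u] := hG7; have [Is Iu] := imaginary_gram_nondegenerate R.
have [S' [S'u S'G]] := symmetric_forms_congruent G7s G7u Is Iu.
apply: isomorphic_trans (OG2_isometry Is G7s S'u S'G).
apply: isomorphic_trans (spin9_locus_OG R).
apply: isomorphic_trans (locus_standard xx xxyy).
rewrite -Txy.
exact: (zero_locus_spin_isometry _ hG9 hgamma (spin9_gram_nondegenerate R) (@spin9_action R) iso).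
Qed.
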